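(* Let $G$ be a second countable, locally compact (Hausdorff) group and let $\mathcal A$ be a separable Fell bundle over $G$. Let $\mathcal H$ be a separable Hilbert space. Any measurable Fell-bundle representation of $\mathcal A$ on $\mathcal H$ is continuous.
   Context: A Fell bundle over the group $G$ is a field of Banach spaces $\mathcal A=(\mathcal A_g)_{g\in G}$ (upper semicontinuous: a topology on $\mathcal A=\bigsqcup_g\mathcal A_g$ such that the projection to $G$ is continuous and open, fibrewise addition and scalar multiplication are continuous, the norm is upper semicontinuous, and every net $a_i\in\mathcal A_{g_i}$ with $g_i\to g$, $\|a_i\|\to0$ converges to $0\in\mathcal A_g$) with bilinear maps $\mathcal A_g\times\mathcal A_h\to\mathcal A_{gh}$ and conjugate-linear maps $\mathcal A_g\to\mathcal A_{g^{-1}}$, $a\mapsto a^*$, continuous on the total spaces, such that multiplication is associative, $(ab)^*=b^*a^*$, $a^{**}=a$, $\|ab\|\le\|a\|\|b\|$, $\|a^*a\|=\|a\|^2$, and for each $a\in\mathcal A_g$ there is $b\in\mathcal A_1$ with $b^*b=a^*a$. Saturation is not required. $\mathcal A$ is separable if the Banach space $C_0(G,\mathcal A)$ of continuous sections vanishing at infinity is separable (for second countable $G$ this amounts to separability of the fibres). A measurable Fell-bundle representation of $\mathcal A$ on $\mathcal H$ consists of linear maps $S_g\colon\mathcal A_g\to\mathbb B(\mathcal H)$ for all $g\in G$ such that $S_g(a_1)S_h(a_2)=S_{gh}(a_1a_2)$ for all $g,h\in G$, $a_1\in\mathcal A_g$, $a_2\in\mathcal A_h$; $S_g(a)^*=S_{g^{-1}}(a^*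 )$ for $a\in\mathcal A_g$; the linear span of $S_1(\mathcal A_1)\mathcal H$ is dense in $\mathcal H$; and for each compactly supported continuous section $f$ of $\mathcal A$ and each measurable function $\xi\colon G\to\mathcal H$ the function $g\mapsto S_g(f(g))\xi(g)$ is measurable. Such a representation is continuous if the map $\mathcal A\to\mathbb B(\mathcal H)$, $\mathcal A_g\ni a\mapsto S_g(a)$, is continuous with respect to the strict topology on $\mathbb B(\mathcal H)=M(\mathbb K(\mathcal H))$; equivalently, $a\mapsto S_g(a)\xi$ is norm-continuous on $\mathcal A$ for each $\xi\in\mathcal H$. *)

(* Defs.v *)
From HB Require Import structures.
From mathcomp Require Export all_boot all_order all_algebra.
From mathcomp Require Export complex.
From mathcomp Require Export all_classical all_reals all_analysis.

Set Implicit Arguments.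
Unset Strict Implicit.
Unset Printing Implicit Defensive.

Import Order.TTheory GRing.Theory Num.Theory.
Import numFieldNormedType.Exports.

Local Open Scope classical_set_scope.
Local Open Scope ring_scope.

HB.mixin Record Group_isTopologicalGroup G of Topological G & Group G := {
  mulg_continuous : continuous (fun x : G * G => (x.1 * x.2)%g);
  invg_continuous : continuous (fun x : G => (x^-1)%g)
}.

#[short(type="topologicalGroupType")]
HB.structure Definition TopologicalGroup :=
  {G of Topological G & Group G & Group_isTopologicalGroup G}.

(* The inner product is linear in its first argument. *)
HB.mixin Record CompleteNormedModule_isHilbert (K : numClosedFieldType) H
    of CompleteNormedModule K H := {
  inner : {dot H for Num.conj};
  normr_inner : forall x : H, `|x| ^+ 2 = inner x x
}.

#[short(type="hilbertType")]
HB.structure Definition Hilbert (K : numClosedFieldType) :=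
  {H of CompleteNormedModule K H & CompleteNormedModule_isHilbert K H}.

Definition separable_space (T : topologicalType) : Prop :=
  exists2 D : set T, countable D & dense D.

Definition borel_measurable_fun (X Y : topologicalType) (f : X -> Y) : Prop :=
  forall B, <<s @open Y >> B -> <<s @open X >> (f @^-1` B).

(* The elements of B(H); for linear maps, continuity is boundedness. *)
Record bounded_operator (K : numClosedFieldType) (H : hilbertType K) :=
  BoundedOperator {
    bop :> {linear H -> H};
    bop_continuous : continuous bop
  }.

Definition compact_operator (K : numClosedFieldType) (H : hilbertType K)
    (T : bounded_operator H) : Prop :=
  precompact (T @` [set x : H | `|x| <= 1]).

(* Continuity for the strict topology on B(H) = M(K(H)), i.e. the topology of
   the seminorms T |-> ||T k|| and T |-> ||k T|| for k in K(H).  The bound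
   "||L|| <= e" on an operator norm is written "|L v| <= e |v| for all v". *)
Definition strictly_continuous (K : numClosedFieldType) (H : hilbertType K)
    (X : topologicalType) (F : X -> bounded_operator H) : Prop :=
  forall k : bounded_operator H, compact_operator k ->
  forall (x : X) (e : K), 0 < e -> \forall y \near x,
    (forall v : H, `|F y (k v) - F x (k v)| <= e * `|v|) /\
    (forall v : H, `|k (F y v) - k (F x v)| <= e * `|v|).

Section FellBundles.
Variables (R : realType) (G : topologicalGroupType).
Local Notation C := R[i].

(* A family of Banach spaces with a topology, given by its open sets, on the
   disjoint union of the fibres. *)
Record banach_family := BanachFamily {
  fiber :> G -> completeNormedModType C;
  total_open : set_system {g : G & fiber g};
  total_openT : total_open setT;
  total_openI : setI_closed total_open;
  total_open_bigU : forall (I : Type) (f : I -> set {g : G & fiber g}),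
    (forall i, total_open (f i)) -> total_open (\bigcup_i f i)
}.

(* The total space.  The constant "total" keeps its topology apart from the
   disjoint sum topology that the library puts on sigma types. *)
Definition total (A : banach_family) : Type := {g : G & A g}.

HB.instance Definition _ (A : banach_family) := gen_eqMixin (total A).
HB.instance Definition _ (A : banach_family) := gen_choiceMixin (total A).
HB.instance Definition _ (A : banach_family) :=
  isOpenTopological.Build (total A)
    (@total_openT A) (@total_openI A) (@total_open_bigU A).

Definition intot (A : banach_family) (g : G) (a : A g) : total A :=
  existT _ g a.

Definition proj (A : banach_family) (x : total A) : G := projT1 x.

Definition tnorm (A : banach_family) (x : total A) : C := `|projT2 x|.

Definition tscale (A : banach_family) (l : C) (x : total A) : total A :=
  intot (l *: projT2 x).

Record usc_banach_field (A : banach_family) : Prop := UscBanachField {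
  proj_continuous : continuous (@proj A);
  proj_open : forall U : set (total A), open U -> open (@proj A @` U);
  (* continuity of addition on the fibre product {(x, y) | proj x = proj y} *)
  fadd_continuous : forall (g : G) (a b : A g) (W : set (total A)),
    nbhs (intot (a + b)) W ->
    \forall x \near intot a & y \near intot b,
      forall (h : G) (a' b' : A h), x = intot a' -> y = intot b' ->
        W (intot (a' + b'));
  fscale_continuous :
    continuous (fun z : C^o * total A => tscale z.1 z.2);
  tnorm_usc : forall (x : total A) (r : C), tnorm x < r ->
    \forall y \near x, tnorm y < r;
  (* convergence of nets, phrased with filters *)
  cvg_tnorm0 : forall (F : set_system (total A)) (g : G), ProperFilter F ->
    @proj A x @[x --> F] --> g ->
    @tnorm A x @[x --> F] --> (0 : C^o) ->
    F --> intot (0 : A g)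
}.

(* The multiplication and involution laws that relate elements of fibres whose
   indices are only propositionally equal, such as A_((gh)k) and A_(g(hk)), are
   equations in the total space. *)
Record fell_bundle := FellBundle {
  fb_field :> banach_family;
  fb_usc : usc_banach_field fb_field;
  fmul : forall g h : G,
    {bilinear fb_field g -> fb_field h -> fb_field (g * h)%g};
  fstar : forall g : G,
    {linear fb_field g -> fb_field (g^-1)%g | Num.conj \; *:%R};
  fmul_continuous : continuous (fun z : total fb_field * total fb_field =>
    intot (fmul _ _ (projT2 z.1) (projT2 z.2)));
  fstar_continuous : continuous (fun x : total fb_field =>
    intot (fstar _ (projT2 x)));
  fmulA : forall (g h k : G)
      (a : fb_field g) (b : fb_field h) (c : fb_field k),
    intot (fmul _ _ a (fmul _ _ b c)) = intot (fmul _ _ (fmul _ _ a b) c);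
  fstarM : forall (g h : G) (a : fb_field g) (b : fb_field h),
    intot (fstar _ (fmul _ _ a b)) =
    intot (fmul _ _ (fstar _ b) (fstar _ a));
  fstarK : forall (g : G) (a : fb_field g),
    intot (fstar _ (fstar _ a)) = intot a;
  fnormM : forall (g h : G) (a : fb_field g) (b : fb_field h),
    `|fmul _ _ a b| <= `|a| * `|b|;
  fnorm_star : forall (g : G) (a : fb_field g),
    `|fmul _ _ (fstar _ a) a| = `|a| ^+ 2;
  fpositive : forall (g : G) (a : fb_field g), exists b : fb_field 1%g,
    intot (fmul _ _ (fstar _ b) b) = intot (fmul _ _ (fstar _ a) a)
}.

Definition continuous_section (A : banach_family) (f : forall g, A g) : Prop :=
  continuous (fun g : G => intot (f g)).

Definition compactly_supported (A : banach_family) (f : forall g, A g) : Prop :=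
  compact (closure [set g | f g != 0]).

Definition vanishes_at_infinity (A : banach_family) (f : forall g, A g) :
    Prop :=
  forall e : C, 0 < e ->
    exists2 K : set G, compact K & forall g, ~ K g -> `|f g| < e.

Definition C0_sections (A : banach_family) : set (forall g, A g) :=
  [set f | continuous_section f /\ vanishes_at_infinity f].

(* Separability of C_0(G, A) for the supremum norm. *)
Definition separable_fell_bundle (A : fell_bundle) : Prop :=
  exists D : set (forall g, A g),
    [/\ countable D, D `<=` @C0_sections A &
      forall f, @C0_sections A f -> forall e : C, 0 < e ->
        exists2 d, D d & forall g, `|f g - d g| <= e].

Record measurable_fell_representation (A : fell_bundle) (H : hilbertType C)
    (S : forall g : G, A g -> bounded_operator H) : Prop :=
  MeasurableFellRepresentation {
    rep_linear : forall (g : G) (l : C) (a b : A g) (v : H),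
      S g (l *: a + b) v = l *: S g a v + S g b v;
    rep_mul : forall (g h : G) (a : A g) (b : A h) (v : H),
      S g a (S h b v) = S _ (fmul A _ _ a b) v;
    (* S_g(a)^* = S_(g^-1)(a^* ) *)
    rep_star : forall (g : G) (a : A g) (v w : H),
      inner (S g a v) w = inner v (S _ (fstar A _ a) w);
    rep_nondegenerate :
      dense [set w : H | exists s : seq (C * A 1%g * H),
        w = \sum_(t <- s) t.1.1 *: S 1%g t.1.2 t.2];
    rep_measurable : forall (f : forall g, A g) (xi : G -> H),
      continuous_section f -> compactly_supported f ->
      borel_measurable_fun xi ->
      borel_measurable_fun (fun g => S g (f g) (xi g))
  }.

Definition continuous_fell_representation (A : fell_bundle) (H : hilbertType C)
    (S : forall g : G, A g -> bounded_operator H) : Prop :=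
  strictly_continuous (fun x : total A => S (proj x) (projT2 x)).

End FellBundles.

(* Main.v *)
Require Import Defs.
From HB Require Import structures.
From mathcomp Require Import all_boot all_order all_algebra complex.
From mathcomp Require Import all_classical all_reals all_analysis.
From mathcomp Require Import lra ring.
Set Implicit Arguments.
Unset Strict Implicit.
Unset Printing Implicit Defensive.
Import Order.TTheory GRing.Theory Num.Theory.
Import numFieldNormedType.Exports.
Local Open Scope classical_set_scope.
Local Open Scope ring_scope.

(** A representation is contractive, [|S_g(a) v| <= |a| |v|]:
    if [|a| < 1], the unit fibre contains a self-adjoint [d] with
    [a^* a = 2d - d^2], so [|S(a) v|^2 = <v, S(a^* a) v>] equals
    [|v|^2 - |(1 - S(d)) v|^2] ([rep_contract]).  Contractivity reduces
    strong continuity to a dense set of vectors, such as the span of the vectors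
    [S_1(b c^* ) v] with [b], [c] in the unit fibre.

    Measurability enters through category instead of Haar measure.  A Borel map
    from [G] to a second countable space is continuous on the complement of a
    meager set.  There are countably many continuous sections that are fibrewise
    dense and countably many vectors that are dense in [H]; so, near a given
    point, there is one meager set [M] such that [a |-> S(a) v] is continuous
    over the complement of [M] ([generic_strong]).

    It remains to remove [M].  Let [p] be a continuous section and let [g_n]
    converge to [g].  If [k] is close to [1], then [b] and [c] have neighbours
    [x], [y] in the fibre over [k] with [x y^*] close to [b c^*], so that
    [S(p(g_n)) S(b c^* ) v] is close to [S(p(g_n) x) S(y^* ) v], uniformly in
    [n].  The elements [p(g_n) x] converge to [p(g) x] and lie over [g_n k] and
    [g k].  Only a meager set of [k] is bad for one of these countably many
    points, so the Baire theorem provides a [k] for which all of them avoid [M],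
    and then [S(p(g_n) x)] converges strongly ([section_strong]).  The
    neighbours [x] and [y] exist because the bundle projection is open.

    Measurability and separability speak of continuous sections, so there have to
    be enough of them: every element of a fibre is approximated by the values of compactly supported continuous
    sections ([section_near], the theorem of Douady and dal Soglio-Herault).

    Finally, a bounded strongly continuous family whose adjoints are strongly
    continuous is strictly continuous, because compact operators map the unit
    ball to a totally bounded set ([strong_strictly_continuous]). *)

Local Notation total := Defs.total.
Local Notation proj := Defs.proj.

(** * Baire category and cutoff functions *)

Section BaireCategory.
Variables (X : topologicalType).

Definition meager (M : set X) : Prop :=
  exists2 F : nat -> set X, (forall n, closed (F n) /\ (F n)° = set0) &
    M `<=` \bigcup_n F n.

Lemma meagerS (M N : set X) : M `<=` N -> meager N -> meager M.
Proof. by move=> MN [F ? NF]; exists F => //; exact: subset_trans NF. Qed.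

Lemma meager_closed (F : set X) : closed F -> F° = set0 -> meager F.
Proof. by move=> cF F0; exists (fun=> F) => // x Fx; exists 0%N. Qed.

Lemma meager_bigcup (M : nat -> set X) :
  (forall n, meager (M n)) -> meager (\bigcup_n M n).
Proof.
move=> mM.
have /choice[F FP] : forall n, exists F : nat -> set X,
    (forall k, closed (F k) /\ (F k)° = set0) /\ M n `<=` \bigcup_k F k.
  by move=> n; have [F ? ?] := mM n; exists F.
exists (fun k => if @unpickle (nat * nat)%type k is Some ij then F ij.1 ij.2
                 else set0).
  move=> k; case: unpickle => [[i j]|]; first exact: (FP i).1.
  by split; [exact: closed0 | exact: interior0].
move=> x [n _ /(FP n).2[k _ Fx]]; exists (pickle (n, k)) => //.
by rewrite pickleK.
Qed.

Lemma meagerU (M N : set X) : meager M -> meager N -> meager (M `|` N).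
Proof.
move=> mM mN; apply: (@meagerS _ (\bigcup_n (if n is 0%N then M else N))).
  by move=> x [?|?]; [exists 0%N | exists 1%N].
by apply: meager_bigcup => -[].
Qed.

(** Both a map and its inverse must be continuous: the inverse makes preimages
    of sets with empty interior have empty interior. *)
Lemma meager_homeo (phi psi : X -> X) (M : set X) :
  continuous phi -> continuous psi -> cancel phi psi -> cancel psi phi ->
  meager M -> meager (phi @^-1` M).
Proof.
move=> cphi cpsi phiK psiK [F FP MF].
exists (fun n => phi @^-1` F n) => [n|x /MF[n _ Fx]]; last by exists n.
have [cF F0] := FP n; split; first exact: closed_comp.
apply/seteqP; split => // x; rewrite /interior /= => nx.
suff : (F n)° (phi x) by rewrite F0.
have : nbhs (psi (phi x)) (phi @^-1` F n) by rewrite phiK.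
move/cpsi; rewrite /interior /nbhs/=; apply: filterS => y /=.
by rewrite psiK.
Qed.

(** The Baire property: equality with an open set up to a meager set. *)
Definition baire_property (B : set X) : Prop :=
  exists U M, [/\ open U, meager M & forall x, ~ M x -> (B x <-> U x)].

(** The complement of an open set differs from its interior by a closed set
    without interior. *)
Lemma baire_property_setC (B : set X) : baire_property B -> baire_property (~` B).
Proof.
move=> [U [M [oU mM BU]]].
exists (~` U)°, (M `|` (~` U `\` (~` U)°)); split; first exact: open_interior.
  apply: meagerU mM _; apply: meager_closed.
    rewrite setDE; apply: closedI; first exact: open_closedC.
    exact: open_closedC (open_interior _).
  apply/seteqP; split => // x; rewrite /interior/= => nx.
  have := nbhs_singleton nx; rewrite /setD/= => -[_]; apply.
  by apply: filterS nx => y [].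
move=> x nM; have [nMx nDx] : ~ M x /\ ~ (~` U `\` (~` U)°) x.
  by split=> ?; apply: nM; [left | right].
split=> [nBx|]; last by move=> /interior_subset nUx /(BU _ nMx).
apply: contrapT => nUx; apply: nDx; split => // Ux.
by apply: nBx; apply/(BU _ nMx).
Qed.

Lemma borel_baire_property (B : set X) : <<s @open X >> B -> baire_property B.
Proof.
apply: smallest_sub; last first.
  move=> U oU; exists U, set0; split => //.
  by apply: meager_closed; [exact: closed0 | exact: interior0].
split.
- exists set0, set0; split => //; first exact: open0.
  by apply: meager_closed; [exact: closed0 | exact: interior0].
- by move=> A; rewrite setTD; exact: baire_property_setC.
move=> A bA.
have /choice[U UP] : forall n, exists U, exists M,
    [/\ open U, meager M & forall x, ~ M x -> (A n x <-> U x)] by exact: bA.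
have /choice[M MP] := UP.
exists (\bigcup_n U n), (\bigcup_n M n); split.
- by apply: bigcup_open => n _; have [] := MP n.
- by apply: meager_bigcup => n; have [] := MP n.
move=> x nM; have nMn n : ~ M n x by move=> ?; apply: nM; exists n.
by split=> -[n _ h]; exists n => //; have [_ _ /(_ x (nMn n))[]] := MP n; auto.
Qed.

(** For a countable base [B] of the target, each [f^-1(B n)] is open up to a
    meager set; the union of these meager sets carries all discontinuities. *)
Lemma borel_generic_continuity (Y : topologicalType) (B : nat -> set Y)
    (f : X -> Y) :
  (forall n, open (B n)) ->
  (forall y W, nbhs y W -> exists2 n, B n y & B n `<=` W) ->
  borel_measurable_fun f ->
  exists2 M, meager M & forall x, ~ M x -> forall W, nbhs (f x) W ->
    \forall y \near x, ~ M y -> W (f y).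
Proof.
move=> oB basB bf.
have bpB n : baire_property (f @^-1` B n).
  by apply: borel_baire_property; apply: bf; exact: sub_sigma_algebra.
have /choice[U UP] : forall n, exists U, exists M,
    [/\ open U, meager M & forall x, ~ M x -> (B n (f x) <-> U x)] by exact: bpB.
have /choice[M MP] := UP.
exists (\bigcup_n M n); first by apply: meager_bigcup => n; have [] := MP n.
move=> x nMx W /basB[n Bnx BnW].
have nMn y : ~ (\bigcup_n M n) y -> ~ M n y by move=> h ?; apply: h; exists n.
have [oU _ h] := MP n.
have Ux : U n x by apply/(h _ (nMn _ nMx)).
have : nbhs x (U n) by exact: open_nbhs_nbhs.
by apply: filterS => y Uy nMy; apply/BnW/(h _ (nMn _ nMy)).
Qed.

Variable R : realType.
Hypotheses (lcX : locally_compact [set: X]) (hX : hausdorff_space X).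

(** Composing a Urysohn function [f] that vanishes at [g] with a piecewise
    linear map makes the function constant near [g] and gives it a support inside
    [f <= 2/3]. *)
Lemma cutoff (g : X) (W : set X) : nbhs g W ->
  exists u : X -> R, [/\ continuous u, forall x, 0 <= u x <= 1,
    \forall x \near g, u x = 1, compact (closure [set x | u x != 0]) &
    closure [set x | u x != 0] `<=` W].
Proof.
move=> nW; have [K] := lcX (I : [set: X] g); rewrite withinET => nK [cK clK].
pose V := (W `&` K)°.
have gV : V g by exact: filterI.
have /uniform_separatorP -/(_ R)[f [cf f01 fg fV]] :
    uniform_separator [set g] (~` V).
  apply: locally_compact_completely_regular => //.
  by apply: open_closedC; exact: open_interior.
have fg0 : f g = 0 by apply: fg; exists g.
pose u x := Num.max 0 (Num.min 1 (2 - 3 * f x)).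
have cu : continuous u.
  have cw : continuous (fun x => 2 - 3 * f x : R^o).
    move=> x; apply: cvgB; first exact: cvg_cst.
    by apply: cvgM; [exact: cvg_cst | exact: cf].
  have cm : continuous ((fun=> 1 : R^o) \min (fun x => 2 - 3 * f x : R^o)).
    by move=> x; apply: continuous_min; [exact: cvg_cst | exact: cw].
  by move=> x; apply: (@continuous_max R X (fun=> 0) _ x);
    [exact: cvg_cst | exact: cm].
have clV : closure [set x | u x != 0] `<=` W `&` K.
  have cl : closed [set x | f x <= 2/3].
    have -> : [set x | f x <= 2/3] = f @^-1` [set y | y <= 2/3] by [].
    by apply: closed_comp => [x _|]; [exact: cf | exact: closed_le].
  have sub : [set x | u x != 0] `<=` [set x | f x <= 2/3].
    move=> x /=; apply: contra_neqT; rewrite -ltNge => h.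
    rewrite /u max_l// ge_min; apply/orP; right.
    rewrite subr_le0; move: h; rewrite ltr_pdivrMr// => /ltW.
    by rewrite mulrC.
  apply: (subset_trans (closureS sub)); rewrite -(closure_id _).1// => x /= h.
  apply: (@interior_subset _ (W `&` K)); apply: contrapT => nV.
  have f1 : f x = 1 by apply: fV; exists x.
  by move: h; rewrite f1 ler_pdivlMr// mul1r ler_nat.
exists u; split => //.
- by move=> x; rewrite /u le_max lexx/= ge_max ler01/= ge_min lexx.
- have : \forall x \near g, f x < 1/3.
    by apply: (cvgr_lt (f g)); [exact: cf | rewrite fg0 divr_gt0].
  apply: filterS => x h; rewrite /u min_l ?max_r//.
  by move: h; rewrite ltr_pdivlMr// mulrC => h; lra.
- apply: (@subclosed_compact _ _ K) => //; first exact: closed_closure.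
  by move=> x /clV[].
- by move=> x /clV[].
Qed.

(** Nested open sets with closures avoiding one closed set after another meet
    by compactness. *)
Lemma baire_locally_compact (M U : set X) :
  open U -> U !=set0 -> meager M -> exists2 x, U x & ~ M x.
Proof.
move=> oU [x0 Ux0] [F FP MF].
have regX : regular_space X.
  apply: (@completely_regular_regular R).
  exact: locally_compact_completely_regular.
have shrink (V : set X) x : open V -> V x ->
    exists W, [/\ open W, W x & closure W `<=` V].
  move=> oV Vx; have [] := regX x V; first exact: open_nbhs_nbhs.
  move=> W nW cW; exists W°; split => //; first exact: open_interior.
  by apply: subset_trans cW; apply: closureS; exact: interior_subset.
have /choice[f fP] : forall nV : nat * set X, exists W,
    open nV.2 -> nV.2 !=set0 ->
    [/\ open W, W !=set0 & closure W `<=` nV.2 `\` F nV.1].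
  move=> [n V]; case: (pselect (open V /\ V !=set0)) => [[oV [x Vx]]|h]; last first.
    by exists set0 => ? ?; exfalso; apply: h.
  have [cF F0] := FP n.
  have : exists y, V y /\ ~ F n y.
    apply: contrapT => h; suff : (F n)° x by rewrite F0.
    apply: filterS (open_nbhs_nbhs (conj oV Vx)) => y Vy.
    by apply: contrapT => nF; apply: h; exists y.
  move=> [y VFy]; have [] := @shrink (V `\` F n) y => //.
    by rewrite setDE; apply: openI => //; exact: closed_openC.
  by move=> W [oW Wy cW]; exists W => _ _; split => //; exists y.
have [K] := lcX (I : [set: X] x0); rewrite withinET => nK [cK clK].
have [] := @shrink (U `&` K°) x0; first by apply: openI => //; exact: open_interior.
  by split.
move=> V0 [oV0 V0x cV0].
pose V := fix V n := if n is n'.+1 then f (n', V n') else V0.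
have VP n : open (V n) /\ V n !=set0.
  elim: n => [|n [ov n0]]; first by split => //; exists x0.
  by have [] := fP (n, V n) ov n0.
have VS n : closure (V n.+1) `<=` V n `\` F n.
  by have [ov n0] := VP n; have [] := fP (n, V n) ov n0.
have Vdec m n : V (m + n)%N `<=` V m.
  elim: n => [|n IH]; first by rewrite addn0.
  rewrite addnS; apply: subset_trans IH => x Vx.
  by have [] := VS _ _ (subset_closure Vx).
pose FF := filter_from [set: nat] V.
have PF : ProperFilter FF.
  apply: filter_from_proper; last by move=> n _; exact: (VP n).2.
  apply: filter_from_filter; first by exists 0%N.
  move=> i j _ _; exists (i + j)%N => // x h; split; first exact: (Vdec i j).
  by apply: (Vdec j i); rewrite addnC.
have KF : FF K.
  exists 0%N => // x V0x'; have [_ /interior_subset] := cV0 _ (subset_closure V0x').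
  by [].
have [x [Kx clx]] := cK _ PF KF.
have clV n : closure (V n) x.
  by move=> B nB; apply: clx => //; exists n.
exists x; first by have [] := cV0 _ (clV 0%N).
by move=> /MF[n _ Fx]; have [] := VS n x (clV n.+1).
Qed.

End BaireCategory.

(** The point [x0] turns [X] into a pointed type, as [compact_cover] demands. *)
Lemma compact_finite_cover (X : topologicalType) (x0 : X) (K : set X) :
  compact K -> cover_compact K.
Proof.
pose Xp : ptopologicalType := HB.pack (Topological.sort X)
  (Topological.class X) (isPointed.Build X x0).
move=> cK; have : @compact Xp K by exact: cK.
rewrite compact_cover; exact.
Qed.

Lemma countable_enum (T : Type) (D : set T) : countable D -> D !=set0 ->
  exists2 f : nat -> T, forall n, D (f n) & forall d, D d -> exists n, f n = d.
Proof.
move=> /pfcard_geP[->|[f]] [x Dx]; first by [].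
exists f => [n|d Dd]; first exact: funS.
by have [n _ fn] := @surj _ _ _ _ f d Dd; exists n.
Qed.

(** A decreasing countable neighbourhood base, which makes sequences suffice
    for testing continuity at a point. *)
Lemma second_countable_nbhs (X : topologicalType) (x : X) : @second_countable X ->
  exists2 N : nat -> set X, forall n, nbhs x (N n) &
    forall W, nbhs x W -> exists n, forall m, (n <= m)%N -> N m `<=` W.
Proof.
move=> [B cB [oB bB]].
have bx W : nbhs x W -> exists U, [/\ B U, U x & U `<=` W].
  by move=> /bB[U [BU Ux] UW]; exists U.
have [|//|f fB fP] := @countable_enum _ (B `&` [set U | U x]).
- by apply: sub_countable cB; apply: subset_card_le; exact: subIsetl.
- by have [U [? ? _]] := bx setT filterT; exists U.
have nf n : nbhs x (f n).
  by have [/oB ofn fx] := fB n; apply: open_nbhs_nbhs.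
exists (fun n => \bigcap_(i < n.+1) f i).
  move=> n; elim: n => [|n IH].
    by apply: filterS (nf 0%N) => y fy [|i].
  apply: filterS (filterI IH (nf n.+1)) => y [h fy] i /=.
  by rewrite ltnS leq_eqVlt => /orP[/eqP -> //|]; exact: h.
move=> W /bx[U [BU Ux UW]]; have [n fn] := fP U (conj BU Ux).
exists n => m nm y h; apply: UW; rewrite -fn; exact: h.
Qed.

(** * Real-valued norms over the complex numbers *)

Section RealNorm.
Variable R : realType.
Local Notation C := R[i].
Local Open Scope complex_scope.

(** The norm of a complex normed space takes values in [R[i]], which is only
    partially ordered; its real part allows linear arithmetic over [R]. *)
Definition rnorm (V : normedZmodType C) (x : V) : R := complex.Re `|x|.

Lemma pos_complexE (e : C) : 0 < e -> exists2 r : R, 0 < r & e = r%:C.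
Proof. by case: e => a b; rewrite ltcE/= => /andP[/eqP -> a0]; exists a. Qed.

Section Normed.
Variable V : normedZmodType C.
Implicit Types x y z : V.
Lemma rnormE x : `|x| = (rnorm x)%:C.
Proof.
have := normr_ge0 x; rewrite lecE/= => /andP[/eqP h _].
by rewrite /rnorm; case: `|x| h => a b /= ->.
Qed.
Lemma rnorm_ge0 x : 0 <= rnorm x.
Proof. by have := normr_ge0 x; rewrite rnormE lecR. Qed.
Lemma rnorm_lt x (e : R) : (`|x| < e%:C) = (rnorm x < e).
Proof. by rewrite rnormE ltcR. Qed.
Lemma rnorm_le x (e : R) : (`|x| <= e%:C) = (rnorm x <= e).
Proof. by rewrite rnormE lecR. Qed.
Lemma rnorm0 : rnorm (0 : V) = 0.
Proof. by rewrite /rnorm normr0. Qed.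
Lemma rnorm_eq0 x : rnorm x = 0 -> x = 0.
Proof. by move=> h; apply/eqP; rewrite -normr_eq0 rnormE h. Qed.
Lemma rnormN x : rnorm (- x) = rnorm x. Proof. by rewrite /rnorm normrN. Qed.
Lemma rnormBC x y : rnorm (x - y) = rnorm (y - x). Proof. by rewrite /rnorm distrC. Qed.
Lemma rnormD x y : rnorm (x + y) <= rnorm x + rnorm y.
Proof. by have := ler_normD x y; rewrite !rnormE -rmorphD/= lecR. Qed.
Lemma rnormB_trans z x y : rnorm (x - y) <= rnorm (x - z) + rnorm (z - y).
Proof. by apply: le_trans (rnormD _ _); rewrite addrA subrK. Qed.
Lemma rnorm_le_sub x y : rnorm x <= rnorm (x - y) + rnorm y.
Proof. by apply: le_trans (rnormD _ _); rewrite subrK. Qed.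
End Normed.

Lemma rnorm_real (r : R) : rnorm (r%:C) = `|r|.
Proof. by rewrite /rnorm normc_def /= expr0n /= addr0 sqrtr_sqr. Qed.
Lemma rnormM (l m : C) : rnorm (l * m) = rnorm l * rnorm m.
Proof.
by apply/eqP; rewrite -(inj_eq (@complexI _)) rmorphM/= -!rnormE normrM.
Qed.

Section NormedModule.
Variable V : normedModType C.
Implicit Types x y : V.
Lemma rnormZ (l : C) x : rnorm (l *: x) = rnorm l * rnorm x.
Proof.
by apply/eqP; rewrite -(inj_eq (@complexI _)) rmorphM/= -!rnormE normrZ.
Qed.
Lemma rnormZr (r : R) x : rnorm (r%:C *: x) = `|r| * rnorm x.
Proof. by rewrite rnormZ rnorm_real. Qed.

Lemma nbhs_rnormP x (W : set V) :
  nbhs x W <-> exists2 e : R, 0 < e & forall y, rnorm (y - x) < e -> W y.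
Proof.
split=> [/nbhs_ballP[e /= e0 eW]|[e e0 eW]].
  have [r r0 er] := pos_complexE e0; exists r => // y yx.
  by apply: eW; rewrite -ball_normE/= er rnorm_lt rnormBC.
apply/nbhs_ballP; exists e%:C => /=; first by rewrite ltcR.
by move=> y; rewrite -ball_normE/= rnorm_lt rnormBC; exact: eW.
Qed.
End NormedModule.

(** The bound on the distance to the limit is the tail of a geometric series. *)
Lemma geometric_cvg (V : completeNormedModType C) (x : nat -> V) (c q : R) :
  0 <= q < 1 -> 0 <= c -> (forall n, rnorm (x n.+1 - x n) <= c * q ^+ n) ->
  exists l, forall n, rnorm (l - x n) <= c * q ^+ n / (1 - q).
Proof.
move=> /andP[q0 q1] c0 xq.
have q1' : 0 < 1 - q by rewrite subr_gt0.
have part n k : rnorm (x (n + k)%N - x n) <= c * q ^+ n / (1 - q) * (1 - q ^+ k).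
  elim: k => [|k IH]; first by rewrite addn0 subrr rnorm0 expr0 subrr mulr0.
  apply: le_trans (rnormB_trans (x (n + k)%N) _ _) _.
  rewrite addnS; apply: le_trans (lerD (xq _) IH) _.
  rewrite exprD exprS le_eqVlt; apply/orP; left; apply/eqP.
  by field; rewrite gt_eqF.
have bnd n k : rnorm (x (n + k)%N - x n) <= c * q ^+ n / (1 - q).
  apply: le_trans (part n k) _; rewrite -[leRHS]mulr1 ler_wpM2l//.
    by rewrite !mulr_ge0// ?exprn_ge0// invr_ge0 ltW.
  by rewrite lerBlDr lerDl exprn_ge0.
have small (e : R) : 0 < e -> exists n, c * q ^+ n / (1 - q) < e.
  move=> e0; have : c * q ^+ n / (1 - q) @[n --> \oo] --> (0 : R).
    have -> : (0 : R) = c * 0 / (1 - q) by rewrite mulr0 mul0r.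
    apply: cvgM; last exact: cvg_cst.
    by apply: cvgM; [exact: cvg_cst | apply: cvg_expr; rewrite ger0_norm].
  move=> /cvgr_lt /(_ e e0)[n _ nP]; exists n; exact: (nP n (leqnn n)).
have cx : cvg (x @ \oo).
  apply/cauchy_cvgP/cauchyP => e /pos_complexE[r r0 ->].
  have [n rnorm] := small _ r0; exists (x n).
  exists n => // m /= nm; rewrite -ball_normE/= rnorm_lt rnormBC.
  by apply: le_lt_trans rnorm; rewrite -(subnKC nm); exact: bnd.
move: cx => /cvg_ex[l xl]; exists l => n.
apply/ler_addgt0Pr => e e0.
move: xl => /cvgrPdist_lt/(_ e%:C); rewrite ltcR => /(_ e0)[N _ NP].
have := NP (n + N)%N (leq_addl _ _); rewrite /= rnorm_lt => h.
apply: le_trans (rnormB_trans (x (n + N)%N) _ _) _.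
by rewrite addrC; apply: lerD; [exact: bnd | exact: ltW].
Qed.

End RealNorm.

Lemma normed_countable_base (R : realType) (V : normedModType R[i]) (D : nat -> V) :
  (forall v (e : R), 0 < e -> exists n, rnorm (v - D n) < e) ->
  exists2 B : nat -> set V, forall n, open (B n) &
    forall y W, nbhs y W -> exists2 n, B n y & B n `<=` W.
Proof.
move=> dD; pose b n m := [set y : V | rnorm (y - D n) < m.+1%:R^-1].
exists (fun k => if @unpickle (nat * nat)%type k is Some nm then b nm.1 nm.2
                 else set0).
  move=> k; case: unpickle => [[n m]|]; last exact: open0.
  rewrite openE => y /= yD; apply/nbhs_rnormP.
  exists (m.+1%:R^-1 - rnorm (y - D n)); first by rewrite subr_gt0.
  by move=> z zy; apply: le_lt_trans (rnormB_trans y _ _) _; rewrite -ltrBrDr.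
move=> y W /nbhs_rnormP[e e0 eW].
have [m me] : exists m, m.+1%:R^-1 < e / 2 :> R.
  have e20 : 0 < e / 2 by rewrite divr_gt0.
  have [N _ NP] := near_infty_natSinv_lt (PosNum e20).
  by exists N; exact: (NP N (leqnn N)).
have [n yn] := dD y m.+1%:R^-1 (ltac:(by rewrite invr_gt0)).
exists (pickle (n, m)); rewrite pickleK//= => z /= zn.
apply: eW; apply: le_lt_trans (rnormB_trans (D n) _ _) _.
have zn' : rnorm (z - D n) < m.+1%:R^-1 := zn.
rewrite (rnormBC (D n)); apply: lt_trans (ltrD zn' yn) _.
by rewrite [ltRHS]splitr ltrD.
Qed.

(** * Hilbert spaces and compact operators *)

Section HilbertSpace.
Variables (R : realType).
Local Notation C := R[i].
Local Open Scope complex_scope.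
Variable (H : hilbertType C).
Local Notation Rein x y := (complex.Re (inner x y)).

Lemma inner_rnorm (x : H) : inner x x = (rnorm x ^+ 2)%:C.
Proof. by rewrite -normr_inner rnormE rmorphXn. Qed.

Lemma ReD (x y : C) : complex.Re (x + y) = complex.Re x + complex.Re y.
Proof. by case: x; case: y. Qed.
Lemma ReB (x y : C) : complex.Re (x - y) = complex.Re x - complex.Re y.
Proof. by case: x; case: y. Qed.
Lemma Re_conj (x : C) : complex.Re (Num.conj x) = complex.Re x.
Proof. by case: x. Qed.
Lemma Re_scale (r : R) (x : C) : complex.Re (r%:C * x) = r * complex.Re x.
Proof. by case: x => a b /=; rewrite mul0r subr0. Qed.
Lemma Re_le_rnorm (x : C) : complex.Re x <= rnorm x.
Proof. by have := normc_ge_Re x; rewrite rnormE lecR;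
  apply: le_trans; exact: ler_norm. Qed.
Lemma rnorm2_Re (x : H) : rnorm x ^+ 2 = Rein x x.
Proof. by rewrite inner_rnorm. Qed.

Lemma rnormD2 (x y : H) : rnorm (x + y) ^+ 2 = rnorm x ^+ 2 + rnorm y ^+ 2 + 2 * Rein x y.
Proof. by rewrite !rnorm2_Re dnormD !ReD Re_conj; ring. Qed.

(** Expand [|t x - y|^2 >= 0]; this form of the Cauchy-Schwarz inequality avoids
    square roots. *)
Lemma Re_inner_le (t : R) (x y : H) : 0 < t ->
  2 * Rein x y <= t * rnorm x ^+ 2 + rnorm y ^+ 2 / t.
Proof.
move=> t0; have e : Rein (t%:C *: x) (- y) = - (t * Rein x y).
  have -> : inner (t%:C *: x) (- y) = t%:C * - inner x y.
    by rewrite linearZl_LR/= linearNr.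
  by rewrite Re_scale -mulrN; case: (inner x y).
have := rnormD2 (t%:C *: x) (- y); rewrite e rnormN rnormZr (ger0_norm (ltW t0)) => h.
have : 0 <= rnorm (t%:C *: x - y) ^+ 2 by rewrite sqr_ge0.
rewrite h exprMn => h'.
rewrite -(ler_pM2l t0) mulrDr [t * (_ / t)]mulrC divfK ?gt_eqF//.
by move: h'; lra.
Qed.

Lemma homogeneous_bound (V : normedModType C) (f : H -> V) (e : R) :
  (forall l v, f (l *: v) = l *: f v) ->
  (forall v, rnorm v <= 1 -> rnorm (f v) <= e) -> forall v, rnorm (f v) <= e * rnorm v.
Proof.
move=> fZ f1 v; have [v0|v0] := eqVneq (rnorm v) 0.
  have -> : f v = 0 by rewrite (rnorm_eq0 v0) -(scale0r 0) fZ scale0r.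
  by rewrite rnorm0 v0 mulr0.
have vp : 0 < rnorm v by rewrite lt_neqAle eq_sym v0 rnorm_ge0.
have a : `|(rnorm v)^-1| = (rnorm v)^-1 by rewrite ger0_norm// invr_ge0 ltW.
have := f1 (((rnorm v)^-1)%:C *: v); rewrite fZ !rnormZr a mulVf// lexx => /(_ isT).
by rewrite mulrC ler_pdivrMr.
Qed.

Lemma continuous_linear_bound (k : bounded_operator H) :
  exists2 K : R, 0 < K & forall v, rnorm (k v) <= K * rnorm v.
Proof.
have k0 : k 0 = 0 by exact: linear0.
have := @bop_continuous _ _ k 0 (ball (k 0) 1) (nbhsx_ballx _ _ ltr01).
move=> /nbhs_rnormP[d d0 dk].
have d20 : 0 < d / 2 by rewrite divr_gt0.
exists (d / 2)^-1; first by rewrite invr_gt0.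
apply: homogeneous_bound => [l v|v v1]; first exact: linearZ.
have h : d / 2 * rnorm v < d.
  apply: (@le_lt_trans _ _ (d / 2)); first by rewrite ler_piMr// ltW.
  by rewrite ltr_pdivrMr// ltr_pMr// ltr1n.
have := dk ((d / 2)%:C *: v); rewrite subr0 rnormZr (ger0_norm (ltW d20)).
move=> /(_ h); rewrite -ball_normE/= k0 sub0r normrN linearZ/=.
have -> : (1 : C) = 1%:C by [].
rewrite rnorm_lt rnormZr (ger0_norm (ltW d20)) => /ltW.
by rewrite mulrC -ler_pdivlMr// mul1r.
Qed.

(** Riesz representation of [v |-> <k v, w>] up to [d].  An approximate minimiser
    [r] of [q(u) = |u|^2 - 2 Re <k u, w>] is enough, since
    [q(v + r) - q(r) = |v|^2 - 2 Re (<k v, w> - <v, r>)]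
    and the left-hand side is almost nonnegative. *)
Lemma riesz_approx (k : bounded_operator H) (w : H) (d : R) : 0 < d ->
  exists r : H, forall v, rnorm (inner (k v) w - inner v r) <= d * rnorm v.
Proof.
move=> d0; have [K K0 kK] := continuous_linear_bound k.
pose q (u : H) := rnorm u ^+ 2 - 2 * Rein (k u) w.
have lb u : - (K ^+ 2 * rnorm w ^+ 2) <= q u.
  have K2 : 0 < (K ^+ 2)^-1 by rewrite invr_gt0 exprn_gt0.
  have := Re_inner_le (k u) w K2; rewrite invrK.
  have : (K ^+ 2)^-1 * rnorm (k u) ^+ 2 <= rnorm u ^+ 2.
    rewrite mulrC ler_pdivrMr ?exprn_gt0// -exprMn.
    by rewrite ler_pXn2r// ?nnegrE ?mulr_ge0// ?rnorm_ge0 1?mulrC ?kK// ltW.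
  by rewrite /q; lra.
pose E := range q.
have hE : has_inf E.
  by split; [exists (q 0), 0 | exists (- (K ^+ 2 * rnorm w ^+ 2)) => _ [u _ <-]].
have d2 : 0 < d ^+ 2 by rewrite exprn_gt0.
have [_ [r _ <-] qr] := inf_adherent d2 hE.
exists r.
have step v : 2 * complex.Re (inner (k v) w - inner v r) <= rnorm v ^+ 2 + d ^+ 2.
  have : inf E <= q (v + r) by apply: ge_inf; [exact: hE.2 | exists (v + r)].
  have -> : complex.Re (inner (k v) w - inner v r) = Rein (k v) w - Rein v r.
    exact: ReB.
  have e1 : inner (k (v + r)) w = inner (k v) w + inner (k r) w.
    by rewrite linearD linearDl.
  rewrite /q rnormD2 e1 ReD.
  by move: qr; rewrite /q; lra.
apply: (@homogeneous_bound C^o (fun v => inner (k v) w - inner v r : C^o)).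
  by move=> l v; rewrite linearZ/= !linearZl_LR/= -mulrBr.
move=> v v1; set D := _ - _.
have [->|D0] := eqVneq (rnorm D) 0; first exact: ltW.
have Dp : 0 < rnorm D by rewrite lt_neqAle eq_sym D0 rnorm_ge0.
(* The phase that makes D real and nonnegative. *)
pose th : C := Num.conj D / (rnorm D)%:C.
have eD l : inner (k (l *: v)) w - inner (l *: v) r = l * D.
  by rewrite linearZ/= !linearZl_LR/= -mulrBr.
have := step ((d%:C * th) *: v); rewrite eD.
have -> : d%:C * th * D = (d * rnorm D)%:C.
  rewrite /th mulrA mulrAC -[X in X / _]mulrA [Num.conj D * D]mulrC -normCK rnormE.
  by rewrite expr2 mulrA mulfK ?rmorphM// fmorph_eq0.
have -> : rnorm ((d%:C * th) *: v) = d * rnorm v.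
  rewrite rnormZ rnormM rnorm_real (ger0_norm (ltW d0)) /th.
  have -> : rnorm (Num.conj D / (rnorm D)%:C) = 1; last by rewrite mulr1.
  rewrite rnormM; have -> : rnorm (Num.conj D) = rnorm D by rewrite /rnorm norm_conjC.
  have -> : rnorm ((rnorm D)%:C^-1) = (rnorm D)^-1.
    have i0 : 0 <= (rnorm D)^-1 by rewrite invr_ge0 rnorm_ge0.
    by rewrite -fmorphV rnorm_real (ger0_norm i0).
  by rewrite divff.
rewrite /= => h; have : (d * rnorm v) ^+ 2 <= d ^+ 2.
  have dv : d * rnorm v <= d by rewrite ler_piMr// ltW.
  by rewrite !expr2; apply: ler_pM => //; rewrite mulr_ge0 ?rnorm_ge0// (ltW d0).
move=> h'; rewrite -(ler_pM2l d0); move: h h'; rewrite -expr2; lra.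
Qed.

(** A finite cover of the compact set containing the image of the unit ball, by
    balls of radius [d]. *)
Lemma compact_operator_net (k : bounded_operator H) (d : R) :
  compact_operator k -> 0 < d ->
  exists s : seq H, forall v, rnorm v <= 1 -> exists2 w, w \in s & rnorm (k v - w) < d.
Proof.
move=> [B kB [cB _]] d0.
pose b (w : H) := [set z : H | rnorm (z - w) < d].
have ob w : B w -> open (b w).
  move=> _; rewrite openE => y /= yv; apply/nbhs_rnormP.
  exists (d - rnorm (y - w)); first by rewrite subr_gt0.
  move=> z zy; apply: le_lt_trans (rnormB_trans y _ _) _.
  by rewrite -ltrBrDr.
have [|D _ DP] := compact_finite_cover (0 : H) cB ob.
  by move=> y By; exists y => //; rewrite /b/= subrr rnorm0.
exists (finmap.enum_fset D) => v v1.
have : B (k v) by apply: kB; exists v => //=; rewrite rnormE -[1]/(1%:C) lecR.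
by move=> /DP[w wD kw]; exists w.
Qed.

End HilbertSpace.

(** * Upper semicontinuous fields of Banach spaces *)

Section BanachField.
Variables (R : realType) (G : topologicalGroupType) (A : banach_family R G).
Hypothesis uA : usc_banach_field A.
Local Notation C := R[i].
Local Open Scope complex_scope.

Lemma nbhs_totalI (x : total A) U V : nbhs x U -> nbhs x V -> nbhs x (U `&` V).
Proof. exact: filterI. Qed.

Lemma add_near g (a b : A g) (W : set (total A)) : nbhs (intot (a + b)) W ->
  exists U V, [/\ nbhs (intot a) U, nbhs (intot b) V &
    forall h (a' b' : A h), U (intot a') -> V (intot b') -> W (intot (a' + b'))].
Proof.
move=> /(fadd_continuous uA)[[U V] [/= nU nV] UV].
exists U, V; split => // h a' b' Ua Vb.
exact: (UV (intot a', intot b') (conj Ua Vb) h a' b').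
Qed.

Lemma scale_near (l : C) g (a : A g) (W : set (total A)) :
  nbhs (intot (l *: a)) W ->
  exists2 U, nbhs (intot a) U & exists2 d : R, 0 < d &
    forall l' h (a' : A h), rnorm (l' - l) < d -> U (intot a') ->
      W (intot (l' *: a')).
Proof.
move=> nW; have := @fscale_continuous _ _ _ uA (l, intot a) _ nW.
move=> [[U V] [/= nU nV] UV]; exists V => //.
have [d d0 dU] := (@nbhs_rnormP R C^o l U).1 nU.
by exists d => // l' h a' l'd Va'; apply: (UV (l', intot a')); split => //; exact: dU.
Qed.

Lemma norm_near g (a : A g) (e : R) : rnorm a < e ->
  exists2 U, nbhs (intot a) U & forall h (a' : A h), U (intot a') -> rnorm a' < e.
Proof.
move=> ae; have : tnorm (intot a) < e%:C by rewrite /tnorm/= rnorm_lt.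
move=> /(tnorm_usc uA) h; eexists; first exact: h.
by move=> k a' /=; rewrite /tnorm /= rnorm_lt.
Qed.

Lemma proj_near g (a : A g) (V : set G) : nbhs g V ->
  nbhs (intot a) [set x | V (proj x)].
Proof. by move=> nV; have := @Defs.proj_continuous _ _ _ uA (intot a) V nV. Qed.

(** This is openness of the bundle projection: an element of one fibre has
    neighbours in all nearby fibres. *)
Lemma fiber_near g (a : A g) (U : set (total A)) : nbhs (intot a) U ->
  \forall k \near g, exists x : A k, U (intot x).
Proof.
move=> nU; have oU : open (@Defs.proj R G A @` U°).
  exact: (Defs.proj_open uA (open_interior _)).
have : nbhs g (@Defs.proj R G A @` U°).
  by apply: open_nbhs_nbhs; split => //; exists (intot a).
by apply: filterS => k [[h x] /interior_subset Ux <-]; exists x.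
Qed.

(** Upper semicontinuity of the distance between two elements of the same fibre,
    the main tool for comparing neighbouring elements. *)
Lemma sub_near g (a b : A g) (e : R) : rnorm (a - b) < e ->
  exists U V, [/\ nbhs (intot a) U, nbhs (intot b) V &
    forall h (a' b' : A h), U (intot a') -> V (intot b') -> rnorm (a' - b') < e].
Proof.
move=> /norm_near[W nW WP].
have [U [V [nU nV UV]]] := add_near nW.
move: nV; rewrite -scaleN1r => /scale_near[V' nV' [d d0 VP]].
exists U, V'; split => // h a' b' Ua Vb; apply: WP; apply: UV => //.
by rewrite -scaleN1r; apply: VP => //; rewrite subrr rnorm0.
Qed.

(** The convergence of nets [a_i] with [|a_i| --> 0] says that tubes around the
    zero section form a neighbourhood base; the filter below is the one of tubes. *)
Lemma zero_near g (W : set (total A)) : nbhs (intot (0 : A g)) W ->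
  exists2 V, nbhs g V & exists2 e : R, 0 < e &
    forall h (z : A h), V h -> rnorm z < e -> W (intot z).
Proof.
(* The filter generated by the tubes over neighbourhoods of g. *)
pose D := [set p : set G * R | nbhs g p.1 /\ 0 < p.2].
pose B (p : set G * R) := [set x : total A | p.1 (proj x) /\ rnorm (projT2 x) < p.2].
have PF : ProperFilter (filter_from D B).
  apply: filter_from_proper; last first.
    move=> [V e] [/= nV e0]; exists (intot (0 : A g)).
    by split => /=; [exact: nbhs_singleton | rewrite rnorm0].
  apply: filter_from_filter.
    by exists (setT, 1); split => //=; exact: filterT.
  move=> [V e] [V' e'] [/= nV e0] [/= nV' e0']; exists (V `&` V', Num.min e e').
    by split=> /=; [exact: filterI | rewrite lt_min e0].
  by move=> x [/= [Vx V'x]]; rewrite lt_min => /andP[h h']; split; split.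
move=> nW; have := @cvg_tnorm0 _ _ _ uA _ g PF; rewrite /cvg_to/= => h.
have [] := h _ _ _ nW.
- by move=> V nV; exists (V, 1) => // x [].
- move=> V nV; have [e e0 eV] := (@nbhs_rnormP R C^o 0 V).1 nV.
  exists (setT, e); first by split => //=; exact: filterT.
  move=> x [/= _ xe]; apply: eV; rewrite subr0 /tnorm rnormE rnorm_real ger0_norm//.
  exact: rnorm_ge0.
move=> [V e] [/= nV e0] VW; exists V => //; exists e => // h' z Vh ze.
exact: (VW (intot z)).
Qed.

(** Translate the tubes around zero of [zero_near] by [a]. *)
Lemma tube_near g (a : A g) (W : set (total A)) : nbhs (intot a) W ->
  exists2 U, nbhs (intot a) U & exists2 e : R, 0 < e &
    forall h (x y : A h), U (intot x) -> rnorm (y - x) < e -> W (intot y).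
Proof.
move=> nW; have : nbhs (intot (a + 0)) W by rewrite addr0.
move=> /add_near[U [V [nU nV UV]]].
have [V0 nV0 [e e0 eV]] := zero_near nV.
exists (U `&` [set x | V0 (proj x)]); first by apply: filterI => //; exact: (proj_near a nV0).
exists e => // h x y [Ux Vx] yx; rewrite -(subrK x y) addrC; apply: UV => //.
exact: eV.
Qed.

(** Approximate continuity of a section at [h]: near some [b] over [h], all
    elements of the total space are [e']-close to [f].  The slack [e' < e] is what
    makes convex combinations preserve the notion without loss. *)
Definition eps_continuous (f : forall g, A g) (e : R) (h : G) : Prop :=
  exists b : A h, exists2 e', e' < e & exists2 U, nbhs (intot b) U &
    forall k (x : A k), U (intot x) -> rnorm (x - f k) <= e'.

Lemma eps_continuous_near (f1 f2 : forall g, A g) (e : R) (h : G) :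
  (\forall k \near h, f1 k = f2 k) -> eps_continuous f1 e h ->
  eps_continuous f2 e h.
Proof.
move=> nf [b [e' ee [U nU UP]]]; exists b, e' => //.
exists (U `&` [set x | f1 (proj x) = f2 (proj x)]).
  apply: filterI => //; exact: (proj_near b nf).
by move=> k x [Ux <-]; exact: UP.
Qed.

(** The value [f h] itself need not be the witness [b]; but [b] is close to it, so
    elements near [f h] are still close to [f]. *)
Lemma eps_continuous_continuous (f : forall g, A g) (h : G) :
  (forall e, 0 < e -> eps_continuous f e h) ->
  {for h, continuous (fun k => intot (f k))}.
Proof.
move=> fh W nW; have [U nU [e e0 UW]] := tube_near nW.
have e2 : 0 < e / 2 by rewrite divr_gt0.
have [b [e' ee [U' nU' UP]]] := fh _ e2.
have bf : rnorm (f h - b) <= e'.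
  by rewrite rnormBC; apply: UP; exact: nbhs_singleton.
have [U1 [V1 [nU1 nV1 UV1]]] := sub_near (le_lt_trans bf ee).
have n1 := fiber_near (nbhs_totalI nU nU1); have n2 := fiber_near (nbhs_totalI nU' nV1).
suff : \forall k \near h, W (intot (f k)) by [].
apply: filterS (filterI n2 n1) => k [[x [Ux Vx]] [y [Uy U1y]]].
apply: UW Uy _; rewrite rnormBC.
apply: le_lt_trans (rnormB_trans x _ _) _.
rewrite [ltRHS]splitr ltrD//; first exact: UV1.
exact: le_lt_trans (UP _ _ Ux) ee.
Qed.

(** The convex combination [b] of the two witnesses is a witness: an element near
    [b] is close to a combination of elements near [b1] and [b2], and these exist by
    [fiber_near]. *)
Lemma eps_continuous_convex (f1 f2 : forall g, A g) (e : R) (h : G)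
    (u : G -> R) : {for h, continuous u} ->
  (forall k, 0 <= u k <= 1) -> eps_continuous f1 e h -> eps_continuous f2 e h ->
  eps_continuous (fun k => (1 - u k)%:C *: f1 k + (u k)%:C *: f2 k) e h.
Proof.
move=> cu u01 [b1 [e1 e1e [U1 nU1 U1P]]] [b2 [e2 e2e [U2 nU2 U2P]]].
pose E := Num.max e1 e2; pose d := (e - E) / 2.
have Ee : E < e by rewrite gt_max e1e.
have d0 : 0 < d by rewrite divr_gt0// subr_gt0.
pose b := (1 - u h)%:C *: b1 + (u h)%:C *: b2.
exists b, (E + d); first by rewrite /d; lra.
have : rnorm (b - b) < d by rewrite subrr rnorm0.
move=> /sub_near[W [W' [nW nW' WW']]].
have [X1 [X2 [nX1 nX2 XW]]] := add_near nW'.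
have [Y1 nY1 [d1 d10 Y1P]] := scale_near nX1.
have [Y2 nY2 [d2 d20 Y2P]] := scale_near nX2.
have nu : \forall k \near h, `|u k - u h| < Num.min d1 d2.
  have : 0 < Num.min d1 d2 by rewrite lt_min d10.
  by move: cu => /cvgr_distC_lt/[apply].
have n1 := fiber_near (nbhs_totalI nU1 nY1).
have n2 := fiber_near (nbhs_totalI nU2 nY2).
pose D := [set k | [/\ exists x : A k, (U1 `&` Y1) (intot x),
  exists x : A k, (U2 `&` Y2) (intot x) & `|u k - u h| < Num.min d1 d2]].
have nD : nbhs h D by apply: filterS3 n1 n2 nu.
exists (W `&` [set x | D (proj x)]).
  by apply: filterI => //; exact: (proj_near b nD).
move=> k x [Wx [/= [x1 [Ux1 Yx1]] [x2 [Ux2 Yx2]]]].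
rewrite lt_min => /andP[u1 u2].
pose z := (1 - u k)%:C *: x1 + (u k)%:C *: x2.
have xz : rnorm (x - z) < d.
  apply: WW' => //; apply: XW; [apply: Y1P | apply: Y2P] => //.
    rewrite -rmorphB/= rnorm_real.
    have -> : 1 - u k - (1 - u h) = u h - u k by ring.
    by rewrite distrC.

  by rewrite -rmorphB/= rnorm_real.
apply: le_trans (rnormB_trans z _ _) _; rewrite addrC; apply: lerD (ltW xz).
rewrite opprD addrACA -!scalerBr.
apply: le_trans (rnormD _ _) _; rewrite !rnormZr.
have /andP[u0 u1'] := u01 k; rewrite (ger0_norm u0) ger0_norm ?subr_ge0//.
have h1 : rnorm (x1 - f1 k) <= E by rewrite (le_trans (U1P _ _ Ux1))// le_max lexx.
have h2 : rnorm (x2 - f2 k) <= E.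
  by rewrite (le_trans (U2P _ _ Ux2))// le_max lexx orbT.
have -> : E = (1 - u k) * E + u k * E by ring.
by apply: lerD; apply: ler_wpM2l; rewrite ?subr_ge0.
Qed.

(** Choose the values of [f] in an open set that is thin: any two of its elements
    in the same fibre have distance less than [e / 2]. *)
Lemma local_eps_continuous g (a : A g) (e : R) (U : set (total A)) : 0 < e ->
  nbhs (intot a) U ->
  exists f, exists2 V, nbhs g V & forall k, V k -> eps_continuous f e k /\ U (intot (f k)).
Proof.
move=> e0 nU; have : rnorm (a - a) < e / 2 by rewrite subrr rnorm0 divr_gt0.
move=> /sub_near[U1 [U2 [nU1 nU2 UU]]].
pose W := (U `&` (U1 `&` U2))°.
have nW : nbhs (intot a) W.
  by apply: nbhs_interior; apply: filterI => //; exact: filterI.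
have WS : W `<=` U `&` (U1 `&` U2) by exact: interior_subset.
have sel : forall k, exists x : A k,
    (exists y : A k, W (intot y)) -> W (intot x).
  move=> k; case: (pselect (exists y : A k, W (intot y))) => [[y Wy]|h].
    by exists y.
  by exists 0.
pose f k := projT1 (cid (sel k)).
have fP k : (exists y : A k, W (intot y)) -> W (intot (f k)) := projT2 (cid (sel k)).
exists f; exists [set k | exists y : A k, W (intot y)]; first exact: (fiber_near nW).
move=> k Vk; have Wf := fP k Vk; split; last by have [] := WS _ Wf.
exists (f k), (e / 2); first by rewrite ltr_pdivrMr// ltr_pMr// ltr1n.
exists (W `&` [set x | exists y : A (proj x), W (intot y)]).
  apply: nbhs_totalI; first by apply: open_nbhs_nbhs; split => //; exact: open_interior.
  have := fiber_near (open_nbhs_nbhs (conj (open_interior _) Wf)).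
  exact: (proj_near (f k)).
move=> h x [Wx Vh]; have Wfh := fP h Vh; apply: ltW; apply: UU.
  by have [_ []] := WS _ Wx.
by have [_ []] := WS _ Wfh.
Qed.
End BanachField.

(** * Existence of continuous sections *)

Section Sections.
Variables (R : realType) (G : topologicalGroupType) (A : banach_family R G).
Hypothesis uA : usc_banach_field A.
Hypotheses (lcG : locally_compact [set: G]) (hG : hausdorff_space G).
Local Notation C := R[i].
Local Open Scope complex_scope.

(** Each point lies in the region where the new section [uF.2] is
    [e']-continuous, or has a neighbourhood where the cutoff vanishes.  This dichotomy
    spares partitions of unity: the patches are glued one after the other. *)
Lemma local_refinement (f : forall g, A g) (e e' : R) (h0 : G) :
  eps_continuous f e h0 -> 0 < e' ->
  exists (uF : (G -> R) * (forall g, A g)),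
  [/\ continuous uF.1, forall k, 0 <= uF.1 k <= 1, \forall k \near h0, uF.1 k = 1 &
   forall h, (eps_continuous uF.2 e' h /\ rnorm (uF.2 h - f h) < e) \/
     \forall k \near h, uF.1 k = 0].
Proof.
move=> [b [e1 e1e [U nU UP]]] e'0.
have [F [V nV FV]] := local_eps_continuous uA e'0 nU.
have [u [cu u01 u1 _ uV]] := cutoff R lcG hG nV.
exists (u, F); split => // h; case: (pselect (V h)) => Vh.
  left; have [? ?] := FV h Vh; split => //=.
  by apply: le_lt_trans e1e; exact: UP.
right => /=; have : nbhs h (~` closure [set x | u x != 0]).
  apply: open_nbhs_nbhs; split; last by move=> /uV.
  by apply: closed_openC; exact: closed_closure.
apply: filterS => k /=; apply: contra_notP => /eqP uk.
exact: subset_closure.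
Qed.

(** Glue finitely many patches.  Once a point has been covered by some [u = 1], later
    convex combinations keep the improved accuracy there. *)
Lemma refinement (K : set G) (f : forall g, A g) (e e' : R) : compact K -> 0 < e ->
  0 < e' -> (forall h, K h -> eps_continuous f e h) ->
  exists F, (forall h, K h -> eps_continuous F e' h) /\
    (forall h, K h -> rnorm (F h - f h) < e).
Proof.
move=> cK e0 e'0 gf.
have /choice[p pP] : forall h0 : G, exists uF : (G -> R) * (forall g, A g),
   K h0 -> [/\ continuous uF.1, forall k, 0 <= uF.1 k <= 1,
   \forall k \near h0, uF.1 k = 1 &
   forall h, (eps_continuous uF.2 e' h /\ rnorm (uF.2 h - f h) < e) \/
     \forall k \near h, uF.1 k = 0].
  move=> h0; case: (pselect (K h0)) => Kh; last by exists (fun=> 0, f).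
  by have [uF ?] := local_refinement (gf _ Kh) e'0; exists uF.
pose Q h0 := [set k : G | (p h0).1 k = 1]°.
have [D DK DQ] : finite_subset_cover K Q K.
  apply: (compact_finite_cover 1%g cK) => [h _|h Kh]; first exact: open_interior.
  by exists h => //; have [_ _ ? _] := pP h Kh.
suff [F [F1 F2]] : exists F : forall g, A g,
    (forall h, K h -> (exists2 h0, h0 \in (finmap.enum_fset D) & Q h0 h) ->
      eps_continuous F e' h) /\
    (forall h, K h -> rnorm (F h - f h) < e).
  exists F; split => // h Kh; apply: F1 => //.
  by have [h0 h0D Qh] := DQ h Kh; exists h0.
have : {in (finmap.enum_fset D), forall h, K h} by move=> h /DK; rewrite inE.
elim: (finmap.enum_fset D) => [_|h0 s IH Ks].
  by exists f; split=> [h _ []//|h _]; rewrite subrr rnorm0.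
have [|F [F1 F2]] := IH.
  by move=> h hs; apply: Ks; rewrite inE hs orbT.
have Kh0 : K h0 by apply: Ks; rewrite inE eqxx.
have [cu u01 u1 uP] := pP h0 Kh0.
set u := (p h0).1 in cu u01 u1 uP; set f0 := (p h0).2 in uP.
exists (fun k => (1 - u k)%:C *: F k + (u k)%:C *: f0 k); split.
  move=> h Kh [h1]; rewrite inE => /orP[/eqP -> Qh|h1s Qh].
    have ne : \forall k \near h, f0 k = (1 - u k)%:C *: F k + (u k)%:C *: f0 k.
      move: Qh; apply: filterS => k /= uk.
      by rewrite /u uk subrr scale0r scale1r add0r.
    apply: (eps_continuous_near uA ne).
    have [[]//|n0] := uP h; exfalso.
    have uh1 : u h = 1 := interior_subset Qh.
    by have := nbhs_singleton n0; rewrite uh1 => /eqP; rewrite oner_eq0.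
  have gF : eps_continuous F e' h by apply: F1 => //; exists h1.
  have [[gf0 _]|n0] := uP h; first exact: (eps_continuous_convex uA (cu h) u01 gF gf0).
  apply: (eps_continuous_near uA (f1 := F)) => //; apply: filterS n0 => k ->.
  by rewrite subr0 scale1r scale0r addr0.
move=> h Kh; have [[_ d]|n0] := uP h; last first.
  rewrite (nbhs_singleton n0) subr0 scale1r scale0r addr0; exact: F2.
have -> : (1 - u h)%:C *: F h + (u h)%:C *: f0 h - f h =
          (1 - u h)%:C *: (F h - f h) + (u h)%:C *: (f0 h - f h).
  rewrite !scalerBr addrACA -opprD -scalerDl -rmorphD/= subrK.
  by rewrite scale1r.
apply: le_lt_trans (rnormD _ _) _; rewrite !rnormZr.
have /andP[u0 u1'] := u01 h; rewrite (ger0_norm u0) ger0_norm ?subr_ge0//.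
have dF := F2 h Kh.
have [->|un0] := eqVneq (u h) 0; first by rewrite mul0r addr0 subr0 mul1r.
have -> : e = (1 - u h) * e + u h * e by ring.
apply: ler_ltD; first by apply: ler_wpM2l; rewrite ?subr_ge0// ltW.
by rewrite ltr_pM2l// lt_neqAle eq_sym un0.
Qed.

(** Existence of sections: refine a local approximate section repeatedly with
    errors decreasing geometrically on a compact set [K], pass to the limit in the
    fibres and multiply by a cutoff function with support [K]. *)
Lemma section_near (g : G) (a : A g) (e : R) : 0 < e ->
  exists f, [/\ continuous_section f, compactly_supported f & rnorm (f g - a) < e].
Proof.
move=> e0; pose d := e / 4; have d0 : 0 < d by rewrite divr_gt0.
have na : rnorm (a - a) < d by rewrite subrr rnorm0.
have [U [W [nU nW UW]]] := sub_near uA na.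
have [f0 [V nV f0V]] := local_eps_continuous uA d0 nU.
have [u [cu u01 u1 cptu uV]] := cutoff R lcG hG nV.
set K := closure _ in cptu uV.
have [F [F0 FS]] : exists F : nat -> forall g, A g, F 0%N = f0 /\
    forall n, (forall h, K h -> eps_continuous (F n) (d * 2^-1 ^+ n) h) /\
      (forall h, K h -> rnorm (F n.+1 h - F n h) <= d * 2^-1 ^+ n).
  have /choice[nxt nP] : forall nf : nat * (forall g, A g), exists F : forall g, A g,
      (forall h, K h -> eps_continuous nf.2 (d * 2^-1 ^+ nf.1) h) ->
      (forall h, K h -> eps_continuous F (d * 2^-1 ^+ nf.1.+1) h) /\
      (forall h, K h -> rnorm (F h - nf.2 h) < d * 2^-1 ^+ nf.1).
    move=> [n f] /=; case: (pselect (forall h, K h -> eps_continuous f (d * 2^-1 ^+ n) h)).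
      move=> gf; have dn k : 0 < d * 2^-1 ^+ k by rewrite mulr_gt0// exprn_gt0.
      by have [F FP] := refinement cptu (dn n) (dn n.+1) gf; exists F.
    by move=> ngf; exists f.
  pose F := fix F n := if n is n'.+1 then nxt (n', F n') else f0.
  exists F; split => //.
  have gF n : forall h, K h -> eps_continuous (F n) (d * 2^-1 ^+ n) h.
    elim: n => [h Kh|n IH]; last by have [] := nP (n, F n) IH.
    by rewrite expr0 mulr1; have [] := f0V h (uV h Kh).
  move=> n; split; first exact: gF.
  move=> h Kh; apply: ltW.
  by have [_ ] := nP (n, F n) (gF n); apply.
have half : 0 <= (2^-1 : R) < 1 by rewrite invr_ge0 ler0n/= invf_lt1// ltr1n.
have sel (h : G) : exists l : A h, K h ->
    forall n, rnorm (l - F n h) <= d * 2^-1 ^+ n / (1 - 2^-1).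
  case: (pselect (K h)) => Kh; last by exists 0.
  have [l lP] := geometric_cvg half (ltW d0) (fun n => (FS n).2 h Kh).
  by exists l.
pose f h := projT1 (cid (sel h)).
have fP h : K h -> forall n, rnorm (f h - F n h) <= d * 2^-1 ^+ n / (1 - 2^-1).
  exact: projT2 (cid (sel h)).
have half' : 1 - 2^-1 = 2^-1 :> R by lra.
have gf h : K° h -> forall c, 0 < c -> eps_continuous f c h.
  move=> Kh c c0.
  have [n nc] : exists n, 3 * d * 2^-1 ^+ n < c.
    have : 3 * d * 2^-1 ^+ n @[n --> \oo] --> (0 : R).
      rewrite -(mulr0 (3 * d)); apply: cvgM; first exact: cvg_cst.
      by apply: cvg_expr; rewrite ger0_norm; case/andP: half.
    move=> /cvgr_lt /(_ c c0)[n _ nP]; exists n; exact: (nP n (leqnn n)).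
  have [b [e1 e1d [X nX XP]]] := (FS n).1 h (interior_subset Kh).
  exists b, (3 * d * 2^-1 ^+ n) => //.
  exists (X `&` [set x | K (proj x)]).
    by apply: nbhs_totalI => //; exact: (proj_near uA b Kh).
  move=> k x [Xx Kk]; apply: le_trans (rnormB_trans (F n k) _ _) _.
  have h1 := le_trans (XP _ _ Xx) (ltW e1d).
  have := fP k Kk n; rewrite half' invrK => h2; rewrite (rnormBC (F n k)).
  by apply: le_trans (lerD h1 h2) _; rewrite le_eqVlt; apply/orP; left; apply/eqP; ring.
have Kg : K g.
  by apply: subset_closure => /=; rewrite (nbhs_singleton u1) oner_eq0.
(* Outside K the limit f is arbitrary, but the cutoff u vanishes there. *)
pose s h := (u h)%:C *: f h.
have supS : [set h | s h != 0] `<=` [set h | u h != 0].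
  by move=> h /=; apply: contra_neq => uh; rewrite /s uh scale0r.
exists s; split.
- move=> h; case: (pselect (u h = 0)) => uh; last first.
    have Kh : K° h.
      have : nbhs h [set k | u k != 0].
        by move: (cu h) => /cvgr_neq0; apply; apply/eqP.
      by apply: filterS => k; exact: subset_closure.
    move=> W' nW'; have [X nX [c c0 XW]] := scale_near uA nW'.
    have n1 := @eps_continuous_continuous _ _ _ uA f h (gf h Kh) X nX.
    have n2 : \forall k \near h, `|u k - u h| < c.
      by move: (cu h) => /cvgr_distC_lt/(_ c c0).
    suff : \forall k \near h, W' (intot (s k)) by [].
    apply: (@filterS2 _ (nbhs h) _ _ _ _ _ n1 n2) => k Xk uk; apply: XW => //.
    by rewrite -rmorphB/= rnorm_real.
  move=> W'; rewrite /s uh scale0r => nW'.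
  have [X nX [c c0 XW]] := zero_near uA nW'.
  suff : \forall k \near h, W' (intot (s k)) by [].
  case: (pselect (K h)) => Kh; last first.
    have : nbhs h (~` K).
      by apply: open_nbhs_nbhs; split => //; apply: closed_openC; exact: closed_closure.
    move=> nK; apply: filterS (filterI nX nK) => k [Xk nKk].
    have uk : u k = 0 by apply: contra_notP nKk => /eqP uk; exact: subset_closure.
    by apply: XW => //; rewrite /s uk scale0r rnorm0.
  (* At a zero of u it suffices that f is bounded near h. *)
  have [b [e1 e1d [Y nY YP]]] := (FS 0%N).1 h Kh.
  have bB : rnorm b < rnorm b + 1 by rewrite ltrDl.
  have [Y' nY' Y'P] := norm_near uA bB.
  pose B := d + (rnorm b + 1) + 2 * d.
  have B0 : 0 < B by rewrite /B; have := rnorm_ge0 b; lra.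
  have n1 := fiber_near uA (nbhs_totalI nY nY').
  have n2 : \forall k \near h, `|u k - u h| < c / B.
    by move: (cu h) => /cvgr_distC_lt/(_ (c / B)); apply; rewrite divr_gt0.
  apply: filterS3 nX n1 n2 => k Xk [x [Yx Y'x]]; rewrite uh subr0 => uk.
  apply: XW => //; rewrite /s rnormZr.
  case: (pselect (K k)) => Kk; last first.
    have -> : u k = 0 by apply: contra_notP Kk => /eqP ?; exact: subset_closure.
    by rewrite normr0 mul0r.
  have fB : rnorm (f k) <= B.
    apply: le_trans (rnorm_le_sub _ (F 0%N k)) _; rewrite addrC; apply: lerD.
      apply: le_trans (rnorm_le_sub _ x) _; apply: lerD; last exact/ltW/Y'P.
      rewrite rnormBC; apply: le_trans (YP _ _ Yx) _.
      by apply: le_trans (ltW e1d) _; rewrite expr0 mulr1.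
    have := fP k Kk 0%N; rewrite half' invrK expr0 mulr1 => h1.
    by apply: le_trans h1 _; rewrite mulrC.
  apply: (@le_lt_trans _ _ (`|u k| * B)); first by rewrite ler_wpM2l.
  by rewrite -ltr_pdivlMr.
- apply: (subclosed_compact _ cptu); first exact: closed_closure.
  exact: closureS.
have u1g : u g = 1 := nbhs_singleton u1.
rewrite /s u1g scale1r.
apply: le_lt_trans (rnormB_trans (f0 g) _ _) _.
have := fP g Kg 0%N; rewrite F0 half' invrK expr0 mulr1 => h1.
have h2 : rnorm (f0 g - a) < d.
  apply: UW; last exact: nbhs_singleton.
  by have [] := f0V g (nbhs_singleton nV).
by apply: le_lt_trans (lerD h1 (ltW h2)) _; rewrite /d; lra.
Qed.
End Sections.

(** * The algebra of the unit fibre *)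

Section FellBundle.
Variables (R : realType) (G : topologicalGroupType) (A : fell_bundle R G).
Local Notation C := R[i].
Local Open Scope complex_scope.

(** The equality of the indices is a loop, trivial by proof irrelevance. *)
Lemma intot_inj (g : G) : injective (@intot _ _ A g).
Proof.
move=> a b ab; have := projT2_eq ab.
by rewrite (Prop_irrelevance (projT1_eq ab) erefl).
Qed.

(** Products such as [a^* a] live over [g^-1 g], which equals [1] only
    propositionally. *)
Definition castA (g h : G) (e : g = h) 
  : A g -> A h := fun a => eq_rect g (fun k => A k : Type) a h e.

Lemma intot_castA g h (e : g = h) (a : A g) : intot (castA e a) = intot a.
Proof. by case: _ / e. Qed.
Lemma rnorm_castA g h (e : g = h) (a : A g) : rnorm (castA e a) = rnorm a.
Proof. by case: _ / e. Qed.
Lemma castAB g h (e : g = h) (a b : A g) : castA e (a - b) = castA e a - castA e b.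
Proof. by case: _ / e. Qed.
Lemma castAZ g h (e : g = h) (l : C) (a : A g) : castA e (l *: a) = l *: castA e a.
Proof. by case: _ / e. Qed.
Lemma rnorm_intot g h (a : A g) (b : A h) : intot a = intot b -> rnorm a = rnorm b.
Proof. by move/(congr1 (@tnorm _ _ A)); rewrite /tnorm/= !rnormE => /complexI. Qed.

Lemma rnorm_fmul g h (a : A g) (b : A h) : rnorm (fmul A _ _ a b) <= rnorm a * rnorm b.
Proof. by rewrite -lecR rmorphM/= -!rnormE; exact: fnormM. Qed.

Lemma rnorm_fstar_fmul g (a : A g) : rnorm (fmul A _ _ (fstar A _ a) a) = rnorm a ^+ 2.
Proof. by apply: complexI; rewrite rmorphXn/= -!rnormE; exact: fnorm_star. Qed.

(** From [|a|^2 = |a^* a| <= |a^*| |a|] and its analogue for [a^*]. *)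
Lemma rnorm_fstar g (a : A g) : rnorm (fstar A _ a) = rnorm a.
Proof.
have le h (b : A h) : rnorm b <= rnorm (fstar A _ b).
  have := rnorm_ge0 b; rewrite le_eqVlt => /orP[/eqP <-|b0]; first exact: rnorm_ge0.
  rewrite -(ler_pM2r b0); apply: le_trans (rnorm_fmul _ _).
  by rewrite rnorm_fstar_fmul expr2.
apply/eqP; rewrite eq_le le andbT.
by apply: le_trans (le _ _) _; rewrite (rnorm_intot (fstarK a)).
Qed.

Local Notation A1 := (A 1%g).
Definition mul1 (a b : A1) : A1 := castA (mulg1 _) (fmul A _ _ a b).
Definition star1 (a : A1) : A1 := castA (invg1 _) (fstar A _ a).
Definition starmul g (a : A g) : A1 := castA (mulVg g) (fmul A _ _ (fstar A _ a) a).

Lemma rnorm_mul1 a b : rnorm (mul1 a b) <= rnorm a * rnorm b.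
Proof. by rewrite rnorm_castA rnorm_fmul. Qed.
Lemma rnorm_star1 a : rnorm (star1 a) = rnorm a.
Proof. by rewrite rnorm_castA rnorm_fstar. Qed.
Lemma rnorm_starmul g (a : A g) : rnorm (starmul a) = rnorm a ^+ 2.
Proof. by rewrite rnorm_castA rnorm_fstar_fmul. Qed.
Lemma mul1Bl a b c : mul1 (a - b) c = mul1 a c - mul1 b c.
Proof. by rewrite /mul1 linearBl castAB. Qed.
Lemma mul1Br a b c : mul1 c (a - b) = mul1 c a - mul1 c b.
Proof. by rewrite /mul1 linearBr castAB. Qed.
Lemma star1B a b : star1 (a - b) = star1 a - star1 b.
Proof. by rewrite /star1 linearB castAB. Qed.
Lemma star10 : star1 0 = 0.
Proof. by have := star1B 0 0; rewrite !subrr. Qed.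
Lemma star1D a b : star1 (a + b) = star1 a + star1 b.
Proof. by rewrite -{1}[b]opprK star1B -{1}[- b]sub0r star1B star10 sub0r opprK. Qed.
Lemma star1Zr (r : R) a : star1 (r%:C *: a) = r%:C *: star1 a.
Proof.
rewrite /star1 linearZ/= castAZ; congr (_ *: _).
by apply/eqP; rewrite eq_complex/= oppr0 !eqxx.
Qed.
Lemma star1_fix a : intot (fstar A _ a) = intot a -> star1 a = a.
Proof. by move=> h; apply: intot_inj; rewrite intot_castA. Qed.

Lemma fstar_cast g h (e : g = h) (a : A g) :
  intot (fstar A _ (castA e a)) = intot (fstar A _ a).
Proof. by case: _ / e. Qed.
Lemma fmul_intot g g' h h' (a : A g) (a' : A g') (b : A h) (b' : A h') :
  intot a = intot a' -> intot b = intot b' ->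
  intot (fmul A _ _ a b) = intot (fmul A _ _ a' b').
Proof.
pose m (x y : total A) := intot (fmul A _ _ (projT2 x) (projT2 y)).
move=> ea eb; change (m (intot a) (intot b) = m (intot a') (intot b')).
by rewrite ea eb.
Qed.

Lemma star1_starmul g (a : A g) : star1 (starmul a) = starmul a.
Proof.
apply: star1_fix; rewrite /starmul fstar_cast fstarM intot_castA.
by apply: fmul_intot => //; exact: fstarK.
Qed.
Lemma star1_mul1 d : star1 d = d -> star1 (mul1 d d) = mul1 d d.
Proof.
move=> dd; apply: star1_fix; rewrite /mul1 fstar_cast fstarM intot_castA.
by apply: fmul_intot; rewrite -[RHS](congr1 (@intot _ _ A _) dd) intot_castA.
Qed.

(** Formally [d = 1 - sqrt (1 - c)].  It is the fixed point of the map
    [d |-> (c + d^2) / 2], which contracts the ball of radius [|c|] with ratio [|c|] and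
    preserves self-adjointness. *)
Lemma sqrt_one_sub (c : A1) : star1 c = c -> rnorm c < 1 ->
  exists2 d : A1, star1 d = d & c = d + d - mul1 d d.
Proof.
move=> cc c1; pose q := rnorm c; have q0 : 0 <= q := rnorm_ge0 c.
have q01 : 0 <= q < 1 by rewrite q0.
pose T (d : A1) := (2^-1)%:C *: (c + mul1 d d).
pose x := fix x n := if n is n'.+1 then T (x n') else 0 : A1.
have half0 : `|2^-1 : R| = 2^-1 by rewrite ger0_norm.
have c2 d : rnorm (T d) <= 2^-1 * (q + rnorm d * rnorm d).
  by rewrite rnormZr half0 ler_wpM2l// (le_trans (rnormD _ _))// lerD2l rnorm_mul1.
have xq n : rnorm (x n) <= q.
  elim: n => [|n IH] /=; first by rewrite rnorm0.
  apply: le_trans (c2 _) _.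
  have : rnorm (x n) * rnorm (x n) <= q * 1.
    by apply: ler_pM; rewrite ?rnorm_ge0// (le_trans IH)// ltW.
  by rewrite mulr1 => h; lra.
have TB d e : rnorm d <= q -> rnorm e <= q -> rnorm (T d - T e) <= q * rnorm (d - e).
  move=> dq eq; rewrite /T -scalerBr opprD addrACA subrr add0r rnormZr half0.
  have -> : mul1 d d - mul1 e e = mul1 d (d - e) + mul1 (d - e) e.
    by rewrite mul1Br mul1Bl addrA subrK.
  rewrite mulrC ler_pdivrMr//; apply: le_trans (rnormD _ _) _.
  have h1 : rnorm (mul1 d (d - e)) <= q * rnorm (d - e).
    by apply: le_trans (rnorm_mul1 _ _) _; rewrite ler_wpM2r ?rnorm_ge0.
  have h2 : rnorm (mul1 (d - e) e) <= q * rnorm (d - e).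
    by apply: le_trans (rnorm_mul1 _ _) _; rewrite mulrC ler_wpM2r ?rnorm_ge0.
  by lra.
have step n : rnorm (x n.+1 - x n) <= q * q ^+ n.
  elim: n => [|n IH]; first by rewrite expr0 mulr1 subr0 xq.
  rewrite exprS; change (rnorm (T (x n.+1) - T (x n)) <= q * (q * q ^+ n)).
  apply: le_trans (TB _ _ (xq _) (xq _)) _.
  by apply: ler_wpM2l.
have [d dP] := geometric_cvg q01 q0 step.
have q1' : 0 < 1 - q by rewrite subr_gt0.
have small (e : R) : 0 < e -> exists n, rnorm (d - x n) < e /\ rnorm (d - x n.+1) < e.
  move=> e0; have : q * q ^+ n / (1 - q) @[n --> \oo] --> (0 : R).
    have -> : (0 : R) = q * 0 / (1 - q) by rewrite mulr0 mul0r.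
    apply: cvgM; last exact: cvg_cst.
    by apply: cvgM; [exact: cvg_cst | apply: cvg_expr; rewrite ger0_norm].
  move=> /cvgr_lt /(_ e e0)[n _ nP]; exists n.
  by split; apply: le_lt_trans (dP _) _; [apply: (nP n) | apply: (nP n.+1)] => /=.
have eq0 (z : A1) : (forall e : R, 0 < e -> rnorm z <= e) -> z = 0.
  move=> h; apply: rnorm_eq0; apply/eqP; rewrite eq_le rnorm_ge0 andbT.
  by apply/ler_addgt0Pr => e e0; rewrite add0r h.
have dq : rnorm d <= q.
  apply/ler_addgt0Pr => e /small[n [h _]].
  by apply: le_trans (rnorm_le_sub _ (x n)) _; rewrite addrC lerD// ltW.
have sx n : star1 (x n) = x n.
  elim: n => [|n IH] /=; first exact: star10.
  by rewrite /T star1Zr star1D star1_mul1// cc.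
exists d.
  apply/eqP; rewrite -subr_eq0; apply/eqP; apply: eq0 => e e0.
  have [|n [h _]] := small (e / 2); first by rewrite divr_gt0.
  apply: le_trans (rnormB_trans (x n) _ _) _; rewrite -{1}(sx n) -star1B rnorm_star1.
  by rewrite (rnormBC (x n)); lra.
have Td : d = T d.
  apply/eqP; rewrite -subr_eq0; apply/eqP; apply: eq0 => e e0.
  have [|n [h h']] := small (e / 2); first by rewrite divr_gt0.
  apply: le_trans (rnormB_trans (x n.+1) _ _) _.
  have : rnorm (x n.+1 - T d) <= q * rnorm (d - x n) by rewrite rnormBC; exact: TB.
  have : q * rnorm (d - x n) <= 1 * rnorm (d - x n).
    by apply: ler_wpM2r; rewrite ?rnorm_ge0// ltW.
  by rewrite mul1r; lra.
have -> : d + d = 2%:C *: d.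
  by rewrite -[(2%:C)]/((1 + 1)%:C) rmorphD/= scalerDl !scale1r.
by rewrite [X in _ *: X]Td scalerA -rmorphM/= divff// scale1r addrK.
Qed.
End FellBundle.

(** * Representations are contractive *)

Section Representation.
Variables (R : realType) (G : topologicalGroupType) (A : fell_bundle R G).
Local Notation C := R[i].
Local Open Scope complex_scope.
Variables (H : hilbertType C) (S : forall g : G, A g -> bounded_operator H).
Arguments S {g} _.
Hypothesis repS : measurable_fell_representation (@S).
Let uA := fb_usc A.

Lemma rep_castA g h (e : g = h) (a : A g) v : S (castA e a) v = S a v.
Proof. by case: _ / e. Qed.

Lemma rep_intot g h (a : A g) (b : A h) v : intot a = intot b -> S a v = S b v.
Proof.
pose s (x : total A) := S (projT2 x) v.
by move=> ab; change (s (intot a) = s (intot b)); rewrite ab.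
Qed.

Lemma rep_sub g (a b : A g) v : S (a - b) v = S a v - S b v.
Proof.
have := rep_linear repS (-1) b a v.
by rewrite !scaleN1r addrC => ->; rewrite addrC.
Qed.
Lemma rep_add g (a b : A g) v : S (a + b) v = S a v + S b v.
Proof. by have := rep_linear repS 1 a b v; rewrite !scale1r. Qed.
Lemma rep_0 g v : S (0 : A g) v = 0.
Proof. by have := rep_sub (0 : A g) 0 v; rewrite !subrr. Qed.
Lemma rep_scale g (l : C) (a : A g) v : S (l *: a) v = l *: S a v.
Proof. by have := rep_linear repS l a 0 v; rewrite addr0 rep_0 addr0. Qed.

(** With [d] as in [sqrt_one_sub] for [c = a^* a],
    [|S(a) v|^2 = <v, S(c) v> = |v|^2 - |v - S(d) v|^2]. *)
Lemma rep_contract_lt1 g (a : A g) v : rnorm a < 1 -> rnorm (S a v) <= rnorm v.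
Proof.
move=> a1; have c1 : rnorm (starmul a) < 1 by rewrite rnorm_starmul expr_lt1// rnorm_ge0.
have [d dd cd] := sqrt_one_sub (star1_starmul a) c1.
have adj w z : inner (S d w) z = inner w (S d z).
  by rewrite (rep_star repS) -(rep_castA (invg1 _)) -/(star1 d) dd.
have e1 : inner (S a v) (S a v) = inner v (S (starmul a) v).
  by rewrite (rep_star repS) (rep_mul repS) /starmul rep_castA.
have e2 : S (starmul a) v = S d v + S d v - S d (S d v).
  by rewrite cd rep_sub rep_add (rep_mul repS) /mul1 rep_castA.
have e3 : inner (S a v) (S a v) = inner v v - inner (v - S d v) (v - S d v).
  have p : Num.conj (inner v (S d v)) = inner v (S d v).
    have h : inner (S d v) v = Num.conj (inner v (S d v)).
      by rewrite (hermC (inner : {dot H for Num.conj})) /= expr0 mul1r.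
    by rewrite -h adj.
  rewrite e1 e2 dnormB p linearB linearD/= -!adj.
  by ring.
have : rnorm (S a v) ^+ 2 <= rnorm v ^+ 2.
  by rewrite -lecR -!inner_rnorm e3 lerBlDr lerDl dnorm_ge0.
by rewrite ler_pXn2r// nnegrE rnorm_ge0.
Qed.

Lemma rep_contract g (a : A g) v : rnorm (S a v) <= rnorm a * rnorm v.
Proof.
apply/ler_addgt0Pr => e e0.
pose r := rnorm a + e / (rnorm v + 1).
have v1 : 0 < rnorm v + 1 by rewrite ltr_wpDl// rnorm_ge0.
have er : 0 < e / (rnorm v + 1) by rewrite divr_gt0.
have ar : rnorm a < r by rewrite ltrDl.
have r0 : 0 < r by apply: le_lt_trans ar; exact: rnorm_ge0.
have ri0 : `|r^-1| = r^-1 by rewrite ger0_norm// invr_ge0 ltW.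
have : rnorm ((r^-1)%:C *: a) < 1 by rewrite rnormZr ri0 mulrC ltr_pdivrMr// mul1r.
move=> /rep_contract_lt1 => /(_ v); rewrite rep_scale rnormZr ri0 mulrC ler_pdivrMr//.
move=> h; apply: le_trans h _; rewrite mulrC mulrDl lerD2l.
rewrite mulrAC ler_pdivrMr// mulrDr mulr1 lerDl; exact: ltW.
Qed.

Definition strong_at g (a : A g) (v : H) : Prop := forall e : R, 0 < e ->
  exists2 U, nbhs (intot a) U &
    forall k (x : A k), U (intot x) -> rnorm (S x v - S a v) < e.

(** Contractivity makes the approximation uniform near [a]. *)
Lemma strong_at_approx g (a : A g) v :
  (forall e : R, 0 < e -> exists2 w, rnorm (v - w) < e & strong_at a w) ->
  strong_at a v.
Proof.
move=> h e e0; pose B := rnorm a + 1.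
have B0 : 0 < B by rewrite ltr_wpDl// rnorm_ge0.
have aB : rnorm a < B by rewrite ltrDl.
have [|w vw sw] := h (e / (4 * B)); first by rewrite divr_gt0// mulr_gt0.
have [|U nU UP] := sw (e / 4); first by rewrite divr_gt0.
have [V nV VP] := norm_near uA aB.
have bnd k (x : A k) : rnorm x < B -> rnorm (S x v - S x w) <= e / 4.
  move=> xB; rewrite -linearB; apply: le_trans (rep_contract _ _) _.
  apply: le_trans (ler_pM _ _ (ltW xB) (ltW vw)) _; rewrite ?rnorm_ge0//.
  by rewrite le_eqVlt; apply/orP; left; apply/eqP; field; rewrite gt_eqF.
exists (U `&` V); first exact: nbhs_totalI.
move=> k x [Ux Vx].
apply: le_lt_trans (rnormB_trans (S x w) _ _) _.
apply: le_lt_trans (lerD (bnd _ _ (VP _ _ Vx)) (rnormB_trans (S a w) _ _)) _.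
by have := bnd _ _ aB; have := UP _ _ Ux; rewrite (rnormBC (S a w)); lra.
Qed.

Lemma strong_at_comb g (a : A g) (l : C) v w :
  strong_at a v -> strong_at a w -> strong_at a (l *: v + w).
Proof.
move=> sv sw e e0; pose L := rnorm l + 1.
have L0 : 0 < L by rewrite ltr_wpDl// rnorm_ge0.
have [|U nU UP] := sv (e / (2 * L)); first by rewrite divr_gt0// mulr_gt0.
have [|V nV VP] := sw (e / 2); first by rewrite divr_gt0.
exists (U `&` V); first exact: nbhs_totalI.
move=> k x [Ux Vx].
have lin j (y : A j) : S y (l *: v + w) = l *: S y v + S y w by exact: linearP.
rewrite !lin opprD addrACA -scalerBr.
apply: le_lt_trans (rnormD _ _) _; rewrite rnormZ.
have h : rnorm l * rnorm (S x v - S a v) <= L * (e / (2 * L)).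
  by apply: ler_pM; rewrite ?rnorm_ge0// ?lerDl// ltW// UP.
apply: le_lt_trans (lerD h (lexx _)) _.
have -> : L * (e / (2 * L)) = e / 2 by field; rewrite gt_eqF.
by have := VP _ _ Vx; lra.
Qed.

Lemma strong_at_0 g (a : A g) : strong_at a 0.
Proof.
move=> e e0; exists setT; first exact: filterT.
move=> k x _; have S0 j (y : A j) : S y 0 = 0 by exact: linear0.
by rewrite !S0 subrr rnorm0.
Qed.
End Representation.

(** * Continuity over a comeager set *)

Section StrongContinuity.
Variables (R : realType) (G : topologicalGroupType) (A : fell_bundle R G).
Hypotheses (hG : hausdorff_space G) (lcG : locally_compact [set: G]).
Hypothesis sepA : separable_fell_bundle A.
Local Notation C := R[i].
Local Open Scope complex_scope.
Variables (H : hilbertType C) (S : forall g : G, A g -> bounded_operator H).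
Arguments S {g} _.
Hypothesis sepH : separable_space H.
Hypothesis repS : measurable_fell_representation (@S).
Let uA := fb_usc A.

Lemma section_scale (u : G -> R) (f : forall g, A g) : continuous u ->
  continuous_section f -> continuous_section (fun k => (u k)%:C *: f k).
Proof.
move=> cu cf h W nW; have [U nU [d d0 UW]] := scale_near uA nW.
have n1 := cf h U nU.
have n2 : \forall k \near h, `|u k - u h| < d.
  by move: (cu h) => /cvgr_distC_lt/(_ d d0).
suff : \forall k \near h, W (intot ((u k)%:C *: f k)) by [].
apply: (@filterS2 _ (nbhs h) _ _ _ _ _ n1 n2) => k Uk uk; apply: UW => //.
by rewrite -rmorphB/= rnorm_real.
Qed.

Lemma dense_seq : exists D : nat -> H,
  forall v (e : R), 0 < e -> exists n, rnorm (v - D n) < e.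
Proof.
have [D cD dD] := sepH.
have ball_open (v : H) (e : R) : 0 < e -> open [set y : H | rnorm (v - y) < e].
  move=> e0; rewrite openE => y /= yv; apply/nbhs_rnormP.
  exists (e - rnorm (v - y)); first by rewrite subr_gt0.
  move=> z zy; apply: le_lt_trans (rnormB_trans y _ _) _.
  by rewrite addrC -ltrBrDr rnormBC.
have dD' (v : H) (e : R) : 0 < e -> exists2 d, D d & rnorm (v - d) < e.
  move=> e0; have [|d [? ?]] := dD _ _ (ball_open v e e0); last by exists d.
  by exists v => /=; rewrite subrr rnorm0.
have [|f fD fP] := countable_enum cD.
  by have [d Dd _] := dD' 0 1 ltr01; exists d.
exists f => v e e0; have [d Dd vd] := dD' v e e0; have [n fn] := fP d Dd.
by exists n; rewrite fn.
Qed.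

(** A dense sequence in [C_0(G, A)] is fibrewise dense because sections pass close to
    every element. *)
Lemma section_seq : exists D : nat -> forall g, A g,
  (forall n, continuous_section (D n)) /\
  forall g (a : A g) (e : R), 0 < e -> exists n, rnorm (a - D n g) < e.
Proof.
have [D [cD DC0 dD]] := sepA.
have dD' g (a : A g) (e : R) : 0 < e -> exists2 d, D d & rnorm (a - d g) < e.
  move=> e0; have e20 : 0 < e / 2 by rewrite divr_gt0.
  have [f [cf sf fa]] := section_near uA lcG hG a e20.
  have [|d Dd fd] := dD f _ (e / 2)%:C (ltac:(by rewrite ltcR)).
    split => // c c0; exists (closure [set g | f g != 0]) => // k nk.
    have -> : f k = 0 by apply: contra_notP nk => /eqP ?; exact: subset_closure.
    by rewrite normr0.
  exists d => //; apply: le_lt_trans (rnormB_trans (f g) _ _) _.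
  by have := fd g; rewrite rnorm_le (rnormBC a); lra.
have [|f fD fP] := countable_enum cD.
  by have [d Dd _] := dD' 1%g 0 1 ltr01; exists d.
exists f; split => [n|g a e e0]; first by have [] := DC0 _ (fD n).
have [d Dd ad] := dD' g a e e0.
by have [n fn] := fP d Dd; exists n; rewrite fn.
Qed.

(** The countably many maps [k |-> S_k(u(k) D_n(k)) E_m] are Borel, hence continuous
    off one meager set; here [u] is a cutoff function that makes the sections [D_n]
    compactly supported and [O] is a set where [u = 1].  An arbitrary [a] and [v] are
    approximated by some [D_n] and [E_m]. *)
Lemma generic_strong (g0 : G) : exists O M, [/\ open O, O g0, meager M &
  forall g, O g -> ~ M g -> forall (a : A g) v (e : R), 0 < e ->
    exists2 U, nbhs (intot a) U &
      forall k (x : A k), U (intot x) -> ~ M k -> rnorm (S x v - S a v) < e].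
Proof.
have [u [cu u01 u1 cptu _]] := cutoff R lcG hG (filterT : nbhs g0 setT).
have [D [cD dD]] := section_seq.
have [E dE] := dense_seq.
have [B oB bB] := normed_countable_base dE.
pose s n k := (u k)%:C *: D n k.
have cs n : continuous_section (s n) by exact: section_scale.
have supps n : compactly_supported (s n).
  apply: (subclosed_compact _ cptu); first exact: closed_closure.
  apply: closureS => k /=; apply: contra_neq => uk.
  by rewrite /s uk scale0r.
have ms n m : borel_measurable_fun (fun k => S (s n k) (E m)).
  apply: (rep_measurable repS (f := s n) (xi := fun=> E m)) => // Y _.
  case: (pselect (Y (E m))) => YE.
    have -> : (fun=> E m) @^-1` Y = [set: G] by apply/seteqP; split.
    by apply: sub_sigma_algebra; exact: openT.
  have -> : (fun=> E m) @^-1` Y = set0 :> set G by apply/seteqP; split.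
  by apply: sub_sigma_algebra; exact: open0.
have /choice[M MP] : forall nm : nat * nat, exists M : set G, meager M /\
    forall x, ~ M x -> forall W, nbhs (S (s nm.1 x) (E nm.2)) W ->
      \forall y \near x, ~ M y -> W (S (s nm.1 y) (E nm.2)).
  by move=> [n m]; have [M ? ?] := borel_generic_continuity oB bB (ms n m); exists M.
pose MM := \bigcup_k (if @unpickle (nat * nat)%type k is Some nm then M nm else set0).
have subM nm : M nm `<=` MM.
  by move=> x Mx; exists (pickle nm) => //; rewrite pickleK.
exists ([set k | u k = 1]°), MM; split => //.
- exact: open_interior.
- apply: meager_bigcup => k; case: unpickle => [nm|]; first exact: (MP nm).1.
  by apply: meager_closed; [exact: closed0 | exact: interior0].
move=> g Og nMg a v e e0.
pose Q := rnorm a; pose W := 2 * rnorm v + 1 + 2 * (Q + 2).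
have W0 : 0 < W by rewrite /W; have := rnorm_ge0 a; have := rnorm_ge0 v; rewrite -/Q; lra.
(* W collects the coefficients of the five errors estimated at the end. *)
pose d := Num.min 1 (e / W).
have d0 : 0 < d by rewrite lt_min ltr01 divr_gt0.
have d1 : d <= 1 by rewrite ge_min lexx.
have dW : d * W <= e by rewrite -ler_pdivlMr// ge_min lexx orbT.
have [n an] := dD g a d d0.
have [m vm] := dE v d d0.
have aQ : rnorm a < Q + 1 by rewrite ltrDl.
have [U1 nU1 U1P] := norm_near uA aQ.
have [U2 [V2 [nU2 nV2 UV2]]] := sub_near uA an.
have nw : nbhs (S (s n g) (E m)) [set w | rnorm (w - S (s n g) (E m)) < d].
  by apply/nbhs_rnormP; exists d.
have n1 := (MP (n, m)).2 g (fun h => nMg (subM _ _ h)) _ nw.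
have n2 : \forall k \near g, V2 (intot (D n k)) := cD n g V2 nV2.
pose N := [set k | [/\ ~ MM k -> rnorm (S (s n k) (E m) - S (s n g) (E m)) < d,
   V2 (intot (D n k)) & u k = 1]].
have nN : nbhs g N.
  apply: filterS3 n1 n2 Og => k /= h1 h2 h3; split => // nMk; apply: h1.
  by move=> Mk; apply: nMk; exact: subM Mk.
exists ((U1 `&` U2) `&` [set x | N (proj x)]).
  by apply: nbhs_totalI; [exact: nbhs_totalI | exact: (proj_near uA a nN)].
move=> k x [[U1x U2x] [/= h1 h2 uk]] nMk.
have sD j : u j = 1 -> s n j = D n j by rewrite /s => ->; rewrite scale1r.
have ug : u g = 1 := interior_subset Og.
have xQ : rnorm x < Q + 1 := U1P _ _ U1x.
have xD : rnorm (x - D n k) < d by exact: UV2.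
have DQ j (y : A j) : rnorm y < Q + 1 -> rnorm (y - D n j) < d -> rnorm (D n j) <= Q + 2.
  move=> yQ yD; apply: le_trans (rnorm_le_sub _ y) _; rewrite rnormBC; lra.
have S1 j (y : A j) : rnorm (y - D n j) < d -> rnorm (S y v - S (D n j) v) <= d * rnorm v.
  move=> yD; rewrite -(rep_sub repS); apply: le_trans (rep_contract repS _ _) _.
  by apply: ler_wpM2r; [exact: rnorm_ge0 | exact: ltW].
have S2 j : rnorm (D n j) <= Q + 2 -> rnorm (S (D n j) v - S (D n j) (E m)) <= (Q + 2) * d.
  move=> Dj; have -> : S (D n j) v - S (D n j) (E m) = S (D n j) (v - E m).
    by rewrite linearB.
  apply: le_trans (rep_contract repS _ _) _.
  by apply: ler_pM; rewrite ?rnorm_ge0// ltW.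
have := h1 nMk; rewrite !sD// => S3.
have T1 := S1 _ _ xD; have T2 := S1 _ _ an.
have T3 := S2 _ (DQ _ _ xQ xD); have T4 := S2 _ (DQ _ _ aQ an).
have T5 := rnormB_trans (S (D n k) v) (S x v) (S a v).
have T6 := rnormB_trans (S (D n k) (E m)) (S (D n k) v) (S a v).
have T7 := rnormB_trans (S (D n g) (E m)) (S (D n k) (E m)) (S a v).
have T8 := rnormB_trans (S (D n g) v) (S (D n g) (E m)) (S a v).
rewrite (rnormBC _ (S (D n g) v)) (rnormBC (S (D n g) v) (S a v)) in T8.
apply: lt_le_trans dW.
have -> : d * W = d * rnorm v + (Q + 2) * d + d + (Q + 2) * d + d * rnorm v.
  by rewrite /W; ring.
by move: T1 T2 T3 T4 T5 T6 T7 T8 S3; lra.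
Qed.

End StrongContinuity.

(** * From a comeager set to all points *)

Section Strong.
Variables (R : realType) (G : topologicalGroupType) (A : fell_bundle R G).
Hypotheses (hG : hausdorff_space G) (lcG : locally_compact [set: G]).
Hypothesis scG : @second_countable G.
Hypothesis sepA : separable_fell_bundle A.
Local Notation C := R[i].
Local Open Scope complex_scope.
Variables (H : hilbertType C) (S : forall g : G, A g -> bounded_operator H).
Arguments S {g} _.
Hypothesis sepH : separable_space H.
Hypothesis repS : measurable_fell_representation (@S).
Let uA := fb_usc A.

Lemma mul_near g h (a : A g) (b : A h) (W : set (total A)) :
  nbhs (intot (fmul A _ _ a b)) W ->
  exists U V, [/\ nbhs (intot a) U, nbhs (intot b) V &
    forall k l (x : A k) (y : A l), U (intot x) -> V (intot y) ->
      W (intot (fmul A _ _ x y))].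
Proof.
move=> nW; have [[U V] [/= nU nV] UV] := @fmul_continuous _ _ A (intot a, intot b) _ nW.
exists U, V; split => // k l x y Ux Vy.
exact: (UV (intot x, intot y)).
Qed.

Lemma star_near g (a : A g) (W : set (total A)) : nbhs (intot (fstar A _ a)) W ->
  exists2 U, nbhs (intot a) U &
    forall k (x : A k), U (intot x) -> W (intot (fstar A _ x)).
Proof.
move=> nW; have nU := @fstar_continuous _ _ A (intot a) _ nW.
eexists; first exact: nU.
by move=> k x.
Qed.

Definition mulstar g (x y : A g) : A 1%g :=
  castA (mulgV g) (fmul A _ _ x (fstar A _ y)).

(** Products [x y^*] from a nearby fibre approximate [b c^*].  This moves a vector
    [S_1(b c^* ) v] to other fibres. *)
Lemma mulstar_near (b c : A 1%g) (e : R) : 0 < e ->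
  \forall k \near (1%g : G), exists x y : A k, rnorm (mulstar x y - mulstar b c) < e.
Proof.
move=> e0; have : rnorm (mulstar b c - mulstar b c) < e by rewrite subrr rnorm0.
move=> /(sub_near uA)[U [W [nU nW UW]]].
have : nbhs (intot (fmul A _ _ b (fstar A _ c))) U by rewrite -(intot_castA (mulgV 1%g)).
move=> /mul_near[U1 [V1 [nU1 nV1 UV1]]].
have [V2 nV2 V2P] := star_near nV1.
apply: filterS2 (fiber_near uA nU1) (fiber_near uA nV2) => k [x Ux] [y Vy].
exists x, y; apply: UW; last exact: nbhs_singleton.
by rewrite intot_castA; apply: UV1 => //; exact: V2P.
Qed.

Lemma rep_mulstar g (x y : A g) v : S (mulstar x y) v = S x (S (fstar A _ y) v).
Proof. by rewrite (rep_mul repS) rep_castA. Qed.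

Lemma mulg_nbhs (g k : G) (W : set G) : nbhs (g * k)%g W ->
  (\forall h \near g, W (h * k)%g) /\ (\forall h \near k, W (g * h)%g).
Proof.
move=> nW; have [[U V] [/= nU nV] UV] := @mulg_continuous G (g, k) _ nW.
split.
  by apply: filterS nU => h Uh; apply: (UV (h, k)); split => //; exact: nbhs_singleton.
by apply: filterS nV => h Vh; apply: (UV (g, h)); split => //; exact: nbhs_singleton.
Qed.

Lemma meager_translate (g : G) (M : set G) : meager M ->
  meager [set k | M (g * k)%g].
Proof.
have c (h : G) : continuous (fun k : G => (h * k)%g).
  by move=> k W /mulg_nbhs[_].
by apply: (meager_homeo (c g) (c g^-1%g)) => k; rewrite ?mulKg ?mulVKg.
Qed.

(** Were the conclusion false, a sequence [gs n --> g0] would witness it.  The Baire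
    theorem yields one [k] close to [1] for which all [gs n * k] and [g0 * k] avoid the
    exceptional meager set; over these points [S] is strongly continuous, and the
    passage from [p g] to [p g x] costs little because [mulstar x y] is close to
    [mulstar b c]. *)
Lemma section_strong (p : forall g, A g) (b c : A 1%g) (v : H) (g0 : G) (e : R) :
  continuous_section p -> 0 < e ->
  \forall g \near g0, rnorm (S (p g) (S (mulstar b c) v) -
                          S (p g0) (S (mulstar b c) v)) < e.
Proof.
move=> cp e0; set w := S (mulstar b c) v.
have [Om [M [oO Og0 mM OM]]] := generic_strong hG lcG sepA sepH repS g0.
have [N nN NP] := second_countable_nbhs g0 scG.
apply: contrapT => nh.
have /choice[gs gsP] : forall n, exists g, N n g /\ e <= rnorm (S (p g) w - S (p g0) w).
  move=> n; apply: contrapT => ng; apply: nh.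
  apply: filterS (nN n) => g Ng; rewrite ltNge; apply/negP => eg.
  by apply: ng; exists g.
have gsW W : nbhs g0 W -> exists n, forall m, (n <= m)%N -> W (gs m).
  move=> /NP[n nW]; exists n => m /nW; apply; exact: (gsP m).1.
pose B := rnorm (p g0) + 1; pose V := rnorm v + 1.
have B0 : 0 < B by rewrite ltr_wpDl// rnorm_ge0.
have V0 : 0 < V by rewrite ltr_wpDl// rnorm_ge0.
pose d := e / (4 * B * V).
have d0 : 0 < d by rewrite divr_gt0// !mulr_gt0.
have nU := mulstar_near b c d0.
have nO : \forall k \near (1%g : G), Om (g0 * k)%g.
  by apply: (mulg_nbhs _).2; rewrite mulg1; exact: open_nbhs_nbhs.
have [k] : exists2 k, ((fun k => exists x y : A k, rnorm (mulstar x y - mulstar b c) < d)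
      `&` (fun k => Om (g0 * k)%g))° k &
    ~ ((\bigcup_n [set k | M (gs n * k)%g]) `|` [set k | M (g0 * k)%g]) k.
  apply: (baire_locally_compact R lcG hG).
  - exact: open_interior.
  - by exists 1%g; exact: filterI.
  - apply: meagerU; last exact: meager_translate.
    by apply: meager_bigcup => n; exact: meager_translate.
move=> /interior_subset[[x [y xy]] Ok] nk.
have nM0 : ~ M (g0 * k)%g by move=> h; apply: nk; right.
have nMs n : ~ M (gs n * k)%g by move=> h; apply: nk; left; exists n.
pose z := S (fstar A _ y) v.
have e2 : 0 < e / 2 by rewrite divr_gt0.
have [U nUq UP] := OM _ Ok nM0 (fmul A _ _ (p g0) x) z (e / 2) e2.
have [U1 [U2 [nU1 nU2 UU]]] := mul_near nUq.
have pB : rnorm (p g0) < B by rewrite ltrDl.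
have [U3 nU3 U3P] := norm_near uA pB.
have n1 : \forall g \near g0, U1 (intot (p g)) := cp g0 U1 nU1.
have n3 : \forall g \near g0, U3 (intot (p g)) := cp g0 U3 nU3.
have [n nP] := gsW _ (filterI n1 n3).
have [Up1 Up3] := nP n (leqnn n).
have h1 := UP _ _ (UU _ _ _ _ Up1 (nbhs_singleton nU2)) (nMs n).
have h2 g : rnorm (p g) < B -> rnorm (S (p g) w - S (fmul A _ _ (p g) x) z) <= e / 4.
  move=> gB; rewrite -(rep_mul repS) /z -rep_mulstar.
  have -> : S (p g) w - S (p g) (S (mulstar x y) v) =
            S (p g) (S (mulstar b c - mulstar x y) v).
    by rewrite (rep_sub repS) linearB.
  apply: le_trans (rep_contract repS _ _) _.
  have h3 : rnorm (S (mulstar b c - mulstar x y) v) <= d * V.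
    apply: le_trans (rep_contract repS _ _) _.
    by apply: ler_pM; rewrite ?rnorm_ge0// ?lerDl// rnormBC ltW.
  apply: le_trans (ler_pM _ _ (ltW gB) h3) _; rewrite ?rnorm_ge0//.
  rewrite le_eqVlt; apply/orP; left; apply/eqP; rewrite /d; field.
  by rewrite !gt_eqF.
have [_] := gsP n; apply/negP; rewrite -ltNge.
have T1 := h2 _ (U3P _ _ Up3); have T2 := h2 _ pB.
have T3 := rnormB_trans (S (fmul A _ _ (p (gs n)) x) z) (S (p (gs n)) w) (S (p g0) w).
have T4 := rnormB_trans (S (fmul A _ _ (p g0) x) z) (S (fmul A _ _ (p (gs n)) x) z)
  (S (p g0) w).
rewrite rnormBC in T2.
by move: T1 T2 T3 T4 h1; lra.
Qed.

(** Near [a], elements stay close to a section whose value is close to [a]. *)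
Lemma strong_at_mulstar g (a : A g) (b c : A 1%g) (v : H) :
  strong_at (@S) a (S (mulstar b c) v).
Proof.
set w := S _ v => e e0; pose W := rnorm w + 1.
have W0 : 0 < W by rewrite ltr_wpDl// rnorm_ge0.
pose d := e / (4 * W); have d0 : 0 < d by rewrite divr_gt0// mulr_gt0.
have [p [cp _ pa]] := section_near uA lcG hG a d0.
have [U [V [nU nV UV]]] := sub_near uA pa.
have n1 : \forall k \near g, U (intot (p k)) := cp g U nU.
have e2 : 0 < e / 2 by rewrite divr_gt0.
have n2 := section_strong b c v g cp e2.
exists (V `&` [set x | [set k | U (intot (p k)) /\
    rnorm (S (p k) w - S (p g) w) < e / 2] (proj x)]).
  by apply: nbhs_totalI => //; apply: (proj_near uA a); exact: filterI n1 n2.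
move=> k x [Vx [/= Up h]].
have bnd j (y z : A j) : rnorm (z - y) < d -> rnorm (S y w - S z w) <= e / 4.
  move=> yz; rewrite -(rep_sub repS); apply: le_trans (rep_contract repS _ _) _.
  have -> : e / 4 = d * W by rewrite /d; field; rewrite gt_eqF.
  by apply: ler_pM; rewrite ?rnorm_ge0// ?lerDl// rnormBC ltW.
have T1 := bnd _ _ _ (UV _ _ _ Up Vx); have T2 := bnd _ _ _ pa.
have T3 := rnormB_trans (S (p k) w) (S x w) (S a w).
have T4 := rnormB_trans (S (p g) w) (S (p k) w) (S a w).
rewrite rnormBC in T2.
by move: T1 T2 T3 T4 h; lra.
Qed.

Lemma rep_span_dense (v : H) (e : R) : 0 < e ->
  exists s : seq (C * A 1%g * H), rnorm (v - \sum_(t <- s) t.1.1 *: S t.1.2 t.2) < e.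
Proof.
move=> e0; have := rep_nondegenerate repS; move=> /(_ [set y : H | rnorm (v - y) < e]).
case.
- by exists v => /=; rewrite subrr rnorm0.
- rewrite openE => y /= yv; apply/nbhs_rnormP.
  exists (e - rnorm (v - y)); first by rewrite subr_gt0.
  move=> z zy; apply: le_lt_trans (rnormB_trans y _ _) _.
  by rewrite addrC -ltrBrDr rnormBC.
by move=> y [/= yv [s ys]]; exists s; rewrite -ys.
Qed.

(** By nondegeneracy, applied twice, the vectors [S_1(b) S_1(c) u] span a dense
    subspace, and [S_1(b) S_1(c) = S_1(b (c^* )^* )]. *)
Lemma strong_at_all g (a : A g) (v : H) : strong_at (@S) a v.
Proof.
have span (s : seq (C * A 1%g * H)) (f : A 1%g -> H -> H) :
    (forall b u, strong_at (@S) a (f b u)) ->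
    strong_at (@S) a (\sum_(t <- s) t.1.1 *: f t.1.2 t.2).
  move=> fP; elim: s => [|t s IH]; first by rewrite big_nil; exact: strong_at_0.
  by rewrite big_cons; apply: strong_at_comb; [exact: fP | exact: IH].
apply: (strong_at_approx repS) => e e0.
have [s sv] := rep_span_dense v e0.
exists (\sum_(t <- s) t.1.1 *: S t.1.2 t.2) => //.
apply: (span s (fun b u => S b u)) => b u {s sv}.
apply: (strong_at_approx repS) => d d0.
pose B := rnorm b + 1; have B0 : 0 < B by rewrite ltr_wpDl// rnorm_ge0.
have [|s su] := @rep_span_dense u (d / B); first by rewrite divr_gt0.
exists (S b (\sum_(t <- s) t.1.1 *: S t.1.2 t.2)).
  rewrite -linearB; apply: le_lt_trans (rep_contract repS _ _) _.
  apply: (@le_lt_trans _ _ (B * rnorm (u - \sum_(t <- s) t.1.1 *: S t.1.2 t.2))).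
    by apply: ler_wpM2r; [exact: rnorm_ge0 | rewrite lerDl].
  by rewrite mulrC -ltr_pdivlMr.
rewrite linear_sum.
under eq_bigr do rewrite linearZ/=.
apply: (span s (fun c u => S b (S c u))) => c u'.
have -> : S b (S c u') = S (mulstar b (star1 c)) u'.
  by rewrite rep_mulstar; congr (S b _); apply: rep_intot;
     rewrite /star1 fstar_cast fstarK.
exact: strong_at_mulstar.
Qed.
End Strong.

(** * From strong to strict continuity *)

Section Strict.
Variables (R : realType) (G : topologicalGroupType) (A : fell_bundle R G).
Local Notation C := R[i].
Local Open Scope complex_scope.
Variables (H : hilbertType C) (S : forall g : G, A g -> bounded_operator H).
Arguments S {g} _.
Hypothesis repS : measurable_fell_representation (@S).
Hypothesis strongS : forall g (a : A g) v, strong_at (@S) a v.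
Let uA := fb_usc A.

Lemma strong_near_seq g (a : A g) (s : seq H) (e : R) : 0 < e ->
  exists2 U, nbhs (intot a) U &
    forall k (x : A k), U (intot x) -> forall w, w \in s -> rnorm (S x w - S a w) < e.
Proof.
move=> e0; elim: s => [|w s [U nU UP]]; first by exists setT; [exact: filterT|].
have [V nV VP] := strongS a w e0.
exists (U `&` V); first exact: nbhs_totalI.
move=> k x [Ux Vx] w'; rewrite inE => /orP[/eqP ->|]; first exact: VP.
exact: UP.
Qed.

(** On a finite net of the image of the unit ball under [K], strong continuity
    controls [T K] for [T = S(x) - S(a)].  For [u = K T v], choose [w] in the net close to
    [u / B]; then [|u|^2 = <u, u>] is nearly [B <K T v, w>], which is nearly
    [B <v, T^* r>] for a vector [r] representing [<K -, w>], and [T^*] is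
    strongly small because [x^*] is close to [a^*]. *)
Lemma strong_strictly_continuous :
  strictly_continuous (fun x : total A => S (projT2 x)).
Proof.
move=> K cK [g a] _ /pos_complexE[e e0 ->].
(* A bound for the norms of S(x) - S(a) for x near a. *)
pose B := 2 * rnorm a + 1.
have B0 : 0 < B by rewrite /B; have := rnorm_ge0 a; lra.
have aB : rnorm a < rnorm a + 1 by rewrite ltrDl.
have [U0 nU0 U0P] := norm_near uA aB.
pose T k (x : A k) v := S x v - S a v.
have TB k (x : A k) v : U0 (intot x) -> rnorm (T k x v) <= B * rnorm v.
  move=> /U0P xB; apply: le_trans (rnormD _ _) _; rewrite rnormN.
  have h1 := rep_contract repS x v; have h2 := rep_contract repS a v.
  have : rnorm x * rnorm v <= (rnorm a + 1) * rnorm v by rewrite ler_wpM2r ?rnorm_ge0// ltW.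
  rewrite /B; lra.
have TD k (x : A k) v w : T k x (v - w) = T k x v - T k x w.
  have l j (y : A j) : S y (v - w) = S y v - S y w by exact: linearB.
  by rewrite /T !l !opprB addrACA [in RHS]addrACA [- S x w + _]addrC.
have TZ k (x : A k) l v : T k x (l *: v) = l *: T k x v.
  have z j (y : A j) : S y (l *: v) = l *: S y v by exact: linearZ.
  by rewrite /T !z scalerBr.
have KZ l v : K (l *: v) = l *: K v by exact: linearZ.
have KB v w : K (v - w) = K v - K w by exact: linearB.
have d0 : 0 < e / (2 * B) by rewrite divr_gt0// mulr_gt0.
have [s sP] := compact_operator_net cK d0.
have e20 : 0 < e / 2 by rewrite divr_gt0.
have [U1 nU1 U1P] := strong_near_seq a s e20.
(* These constants give B (d1 B + d2) = e^2 / 4, hence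
   |u|^2 <= e^2 / 4 + 2 B (d1 B + d2) <= e^2 below. *)
pose d1 := e ^+ 2 / (8 * B ^+ 2).
have d10 : 0 < d1 by rewrite divr_gt0 ?mulr_gt0 ?exprn_gt0.
pose d2 := e ^+ 2 / (8 * B).
have d20 : 0 < d2 by rewrite divr_gt0 ?mulr_gt0 ?exprn_gt0.
have /choice[r rP] : forall w, exists r : H, forall v,
    rnorm (inner (K v) w - inner v r) <= d1 * rnorm v by move=> w; exact: riesz_approx.
have [U2 nU2 U2P] := strong_near_seq (fstar A _ a) (map r s) d20.
have [U3 nU3 U3P] := star_near nU2.
have nU : nbhs (intot a : total A) ((U0 `&` U1) `&` U3).
  by apply: nbhs_totalI => //; exact: nbhs_totalI.
apply: filterS nU => -[k x] [[U0x U1x] U3x] /=.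
split.
  move=> v; rewrite [in leRHS]rnormE -rmorphM rnorm_le; move: v.
  apply: (@homogeneous_bound _ _ _ (fun v => T k x (K v))) => [l v|v v1].
    by rewrite KZ TZ.
  have [w ws vw] := sP v v1.
  apply: le_trans (rnorm_le_sub _ (T k x w)) _; rewrite -TD.
  have h1 := TB _ _ (K v - w) U0x.
  have h2 : rnorm (T k x w) < e / 2 := U1P _ _ U1x w ws.
  have h3 : B * rnorm (K v - w) <= B * (e / (2 * B)) by rewrite ler_pM2l// ltW.
  have h4 : B * (e / (2 * B)) = e / 2 by field; rewrite gt_eqF.
  by move: h1 h2 h3; rewrite h4; lra.
move=> v; rewrite [in leRHS]rnormE -rmorphM -KB rnorm_le; move: v.
apply: (@homogeneous_bound _ _ _ (fun v => K (T k x v))) => [l v|v v1].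
  by rewrite TZ KZ.
set u := K (T k x v).
have Tv : rnorm (T k x v) <= B.
  by apply: le_trans (TB _ _ _ U0x) _; rewrite ler_piMr// ltW.
have iB0 : `|B^-1| = B^-1 by rewrite ger0_norm// invr_ge0 ltW.
have [|w ws] := sP ((B^-1)%:C *: T k x v).
  by rewrite rnormZr iB0 mulrC ler_pdivrMr// mul1r.
rewrite KZ -/u => uw.
pose z := u - B%:C *: w.
have zB : rnorm z <= e / 2.
  have -> : z = B%:C *: ((B^-1)%:C *: u - w).
    by rewrite scalerBr scalerA -rmorphM/= divff ?gt_eqF// scale1r.
  rewrite rnormZr (ger0_norm (ltW B0)).
  have -> : e / 2 = B * (e / (2 * B)) by field; rewrite gt_eqF.
  by rewrite ler_pM2l// ltW.
have Ruu : rnorm u ^+ 2 = complex.Re (inner u z) + B * complex.Re (inner u w).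
  rewrite rnorm2_Re; have e1 : inner u u = inner u z + B%:C * inner u w.
    have -> : B%:C * inner u w = inner u (B%:C *: w).
      rewrite linearZr_LR /=; congr (_ * _).
      by apply/eqP; rewrite eq_complex/= oppr0 !eqxx.
    by rewrite -linearDr /= /z subrK.
  by rewrite e1 ReD Re_scale.
have R1 := Re_inner_le u z ltr01.
have rw : r w \in map r s by apply/mapP; exists w.
have Ts := U2P _ _ (U3P _ _ U3x) _ rw.
have R2 : complex.Re (inner u w) <= d1 * B + d2.
  have e1 : inner (T k x v) (r w) =
      inner v (S (fstar A _ x) (r w) - S (fstar A _ a) (r w)).
    have -> : inner (T k x v) (r w) = inner (S x v) (r w) - inner (S a v) (r w).
      by rewrite /T linearBl.
    by rewrite !(rep_star repS) -linearBr.
  have R3 := Re_inner_le v (S (fstar A _ x) (r w) - S (fstar A _ a) (r w)) d20.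
  have R4 : complex.Re (inner u w - inner (T k x v) (r w)) <= d1 * B.
    apply: le_trans (Re_le_rnorm _) _; apply: le_trans (rP _ _) _.
    by rewrite ler_pM2l.
  move: R4; rewrite ReB e1.
  have q1 : d2 * rnorm v ^+ 2 <= d2.
    by rewrite ler_piMr ?(ltW d20)// expr_le1// rnorm_ge0.
  have q2 : rnorm (S (fstar A _ x) (r w) - S (fstar A _ a) (r w)) ^+ 2 / d2 <= d2.
    rewrite ler_pdivrMr// -expr2; rewrite !expr2.
    by apply: ler_pM; rewrite ?rnorm_ge0// ltW.
  by move: R3 q1 q2; lra.
have Bd : B * (d1 * B + d2) = e ^+ 2 / 4.
  by rewrite /d1 /d2; field; rewrite gt_eqF.
have R5 : B * complex.Re (inner u w) <= e ^+ 2 / 4 by rewrite -Bd ler_pM2l.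
have z2 : rnorm z ^+ 2 <= e ^+ 2 / 4.
  have -> : e ^+ 2 / 4 = (e / 2) ^+ 2 by field.
  by rewrite !expr2; apply: ler_pM; rewrite ?rnorm_ge0.
have : rnorm u ^+ 2 <= e ^+ 2.
  have e2 : 0 <= e ^+ 2 by exact: sqr_ge0.
  by move: R1 R5 z2 Ruu; rewrite mul1r divr1; lra.
by rewrite ler_pXn2r// nnegrE ?rnorm_ge0// ltW.
Qed.
End Strict.

Theorem theorem12p6 (R : realType) (G : topologicalGroupType)
    (hausG : hausdorff_space G) (lcG : locally_compact [set: G])
    (scG : @second_countable G)
    (A : fell_bundle R G) (sepA : separable_fell_bundle A)
    (H : hilbertType R[i]) (sepH : separable_space H)
    (S : forall g : G, A g -> bounded_operator H)
    (repS : measurable_fell_representation S) :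
  continuous_fell_representation S.
Proof.
apply: strong_strictly_continuous => // g a v; exact: strong_at_all.
Qed.
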